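(* Suppose $f\in W^{1,1}(0,T)$ and $\alpha_0=0$. If $f(0)=0$, then the variable-exponent Abel integral equation $$(k*u)(t)=f(t),\quad t\in[0,T],$$ admits a unique solution $u\in L^1(0,T)$, and $$\|u\|_{L^1(0,T)}\le Q\|f\|_{W^{1,1}(0,T)}.$$ If further $|f'|\le L_f$ for $t\in[0,T]$ for some constant $L_f>0$, then $$|u(t)|\le QL_f,\quad t\in[0,T].$$ Here $Q>0$ denotes constants independent of $f$, $u$, $L_f$ and $t$.
   Context: $T>0$. The variable exponent $\alpha:[0,T]\to\mathbb R$ is three times differentiable with $|\alpha'(t)|+|\alpha''(t)|+|\alpha'''(t)|\le L$ on $[0,T]$ for some $L>0$, with $\alpha_0:=\alpha(0)$ and $0<\alpha(t)<1$ for $t\in(0,T]$. The kernel is $k(t):=\frac{t^{-\alpha(t)}}{\Gamma(1-\alpha(t))}$ and $(k*u)(t)=\int_0^tk(t-s)u(s)\,ds$. Functions in $L^1(0,T)$ are identified up to null sets. *)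

(* Defs.v *)
From mathcomp Require Export all_boot all_order all_algebra.
From mathcomp Require Export all_classical all_reals all_analysis.
Set Implicit Arguments.
Unset Strict Implicit.
Unset Printing Implicit Defensive.
Import Order.TTheory GRing.Theory Num.Theory.
Import numFieldNormedType.Exports.
Local Open Scope classical_set_scope.
Local Open Scope ring_scope.

(* The library has no test functions, no Sobolev spaces on an interval and no
   Gamma function. *)
Section Defs.
Context {R : realType}.
Implicit Types (T : R) (f g u phi alpha k : R -> R).
Local Notation mu := (@lebesgue_measure R).

(* Two-sided derivative at interior points, one-sided at 0 and at T. *)
Definition deriv_on T f g : Prop :=
  forall t, t \in `[0, T] ->
    (f s - f t) / (s - t) @[s --> within `[0, T]%classic t^'] --> g t.

(* Euler's integral, used only for x > 0. *)
Definition Gamma (x : R) : R :=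
  \int[mu]_(t in `]0, +oo[%classic) (t `^ (x - 1) * expR (- t)).

Definition abel_kernel alpha : R -> R :=
  fun t => t `^ (- alpha t) / Gamma (1 - alpha t).

(* [Rintegral] is 0 when the integrand is not integrable; with
   alpha continuous on [0, T], positive and < 1 on ]0, T], and
   alpha t = O(t) at 0, the kernel is bounded on [0, T], so this does not
   happen for u in L^1(0, T) and t in [0, T]. *)
Definition conv k u : R -> R :=
  fun t => \int[mu]_(s in `[0, t]%classic) (k (t - s) * u s).

Definition in_L1 T u : Prop :=
  mu.-integrable `]0, T[%classic (EFin \o u).

Definition L1norm T u : R := \int[mu]_(t in `]0, T[%classic) `|u t|.

Definition test_function T phi : Prop :=
  [/\ forall n x, derivable (derive1n n phi) x 1,
      compact (closure [set x | phi x != 0]) &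
      closure [set x | phi x != 0] `<=` `]0, T[%classic].

Definition weak_derivative T f g : Prop :=
  forall phi, test_function T phi ->
    \int[mu]_(t in `]0, T[%classic) (f t * derive1 phi t) =
    - \int[mu]_(t in `]0, T[%classic) (g t * phi t).

(* f is in W^{1,1}(0, T) with weak derivative g (unique up to null sets);
   f itself is the continuous representative on [0, T], so that the values
   f 0 and f t, 0 <= t <= T, are meaningful. *)
Definition in_W11 T f g : Prop :=
  [/\ {within `[0, T]%classic, continuous f},
      in_L1 T f, in_L1 T g & weak_derivative T f g].

(* g stands for the weak derivative of f. *)
Definition W11norm T f g : R := L1norm T f + L1norm T g.

(* Both sides are continuous on [0, T], so asking for equality everywhere
   or almost everywhere is the same. *)
Definition abel_solution T alpha f u : Prop :=
  in_L1 T u /\ forall t, t \in `[0, T] -> conv (abel_kernel alpha) u t = f t.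

End Defs.

(* Main.v *)
Require Import Defs.
From mathcomp Require Import all_boot all_order all_algebra.
From mathcomp Require Import all_classical all_reals all_analysis.
From mathcomp Require Import measurable_realfun ring lra.
Import Order.TTheory GRing.Theory Num.Theory.
Import numFieldNormedType.Exports.
Local Open Scope classical_set_scope.
Local Open Scope ring_scope.
Set Implicit Arguments.
Unset Strict Implicit.
Unset Printing Implicit Defensive.

(** The kernel k is absolutely continuous with k(0) = 1, and this turns the
    equation of the first kind into a Volterra equation of the second kind.

    Since alpha(0) = 0 and alpha' is bounded, 0 <= alpha(t) <= L t, so
    t^(-alpha(t)) = exp(- alpha(t) ln t) is bounded and tends to 1 at 0, while
    its derivative is O(1 + |ln t|).  Together with the regularity of
    Gamma near the compact range of 1 - alpha inside ]0, 1], this yields an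
    integrable h, the derivative k' extended by 0, with
    k(t) = 1 + int_0^t h on [0, T] ([abel_kernel_primitive]).

    By Fubini, k * u = int_0^t (u + h * u) ([primitive_conv]).  On the other
    side, f in W^{1,1} with f(0) = 0 is the primitive of its weak derivative
    ([W11_primitive], obtained by testing against smooth cutoffs of [0, b]).  A
    function whose primitive vanishes is null ([primitive_eq0_ae]), hence
    k * u = f is equivalent to u + h * u = f' almost everywhere.

    The last equation is solved on L^1 of the line ([volterra_second_kind]).
    Multiplication by exp(- l t) commutes with convolution, in the sense that
    it replaces h by exp(- l t) h and keeps the form of the equation; as h is
    supported in the positive half-line, dominated convergence makes the L^1
    norm of the new kernel at most 1/2 for l large.  The Picard iteration then
    converges in L^1, and contraction gives uniqueness and the norm bound.  For
    the sup bound, if |f'| <= B then p = (|u| - 2 B)^+ satisfies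
    p <= |a| * p for the contracting kernel a, which forces p = 0. *)

(** * Convolution on the line *)

#[global] Instance ae_lebesgue_filter (R : realType) :
  Filter (nbhs (almost_everywhere (@lebesgue_measure R))) :=
  ae_filter_ringOfSetsType (@lebesgue_measure R).

Section Convolution.
Context {R : realType}.
Local Notation mu := (@lebesgue_measure R).
Local Notation L1 f := (mu.-integrable setT (EFin \o f)).
Implicit Types (a b f g : R -> R).

(** Lebesgue measure is determined by its values on half-open intervals, so a
    map that preserves those values preserves integrals. *)
Lemma ge0_integral_comp_preserving (phi : R -> R) (f : R -> \bar R) :
  measurable_fun setT phi ->
  (forall x y, mu (phi @^-1` `]x, y]) = mu `]x, y]) ->
  measurable_fun setT f -> (forall x, 0 <= f x)%E ->
  (\int[mu]_x f (phi x) = \int[mu]_x f x)%E.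
Proof.
move=> mphi phi_itv mf f0.
pose psi : measurableTypeR R -> measurableTypeR R := phi.
have mpsi : measurable_fun [set: measurableTypeR R] psi by exact: mphi.
pose nu :=
  measure_function_pushforward__canonical__measure_function_Measure mu mpsi.
have nuE X : ocitv X -> mu X = nu X.
  by case=> -[x y] /= xy <-; rewrite /pushforward -phi_itv.
have := @ge0_integral_pushforward _ _ _ _ R _ mpsi mu setT f measurableT mf
  (fun y _ => f0 y).
rewrite preimage_setT => <-.
apply: eq_measure_integral => A mA _; symmetry.
exact: (lebesgue_measure_unique nuE).
Qed.

Lemma ge0_integral_shift (x0 : R) (f : R -> \bar R) :
  measurable_fun setT f -> (forall x, 0 <= f x)%E ->
  (\int[mu]_x f (x + x0)%R = \int[mu]_x f x)%E.
Proof.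
apply: ge0_integral_comp_preserving; first exact: measurable_funD.
move=> x y.
have -> : (fun z => z + x0) @^-1` `]x, y]%classic = `]x - x0, y - x0]%classic.
  by apply/seteqP; split => z /=; rewrite !in_itv/= ltrBlDr lerBrDr.
rewrite !lebesgue_measure_itv/= !lte_fin ltrD2r; case: ifP => // _.
by rewrite -!EFinB; congr EFin; ring.
Qed.

Lemma ge0_integral_reflect (x0 : R) (f : R -> \bar R) :
  measurable_fun setT f -> (forall x, 0 <= f x)%E ->
  (\int[mu]_x f (x0 - x)%R = \int[mu]_x f x)%E.
Proof.
apply: ge0_integral_comp_preserving; first exact: measurable_funB.
move=> x y.
have -> : (fun z => x0 - z) @^-1` `]x, y]%classic = `[x0 - y, x0 - x[%classic.
  apply/seteqP; split => z /=; rewrite !in_itv/=.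
    by move=> /andP[xz zy]; apply/andP; split; lra.
  by move=> /andP[xz zy]; apply/andP; split; lra.
rewrite !lebesgue_measure_itv/= !lte_fin ltrD2l ltrN2; case: ifP => // _.
by rewrite -!EFinB; congr EFin; ring.
Qed.

Lemma integrable_normE f : L1 f ->
  (\int[mu]_x `|f x|%R%:E = (\int[mu]_x `|f x|)%R%:E)%E.
Proof.
move=> intf; rewrite /Rintegral fineK//; apply: integrable_fin_num => //.
exact: integrable_norm.
Qed.

(** Convolution over the whole line.  For a kernel vanishing on ]-oo, 0] and a
    function vanishing on ]-oo, 0], it is the convolution over [0, t]. *)
Definition line_conv a b t := \int[mu]_s (a (t - s) * b s).

Section ConvolutionL1.
Variables a b : R -> R.
Hypotheses (inta : L1 a) (intb : L1 b).

Let ma : measurable_fun setT a.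
Proof. by move/integrableP : inta => [/measurable_EFinP]. Qed.

Let mb : measurable_fun setT b.
Proof. by move/integrableP : intb => [/measurable_EFinP]. Qed.

Lemma measurable_conv_integrand :
  measurable_fun [set: R * R] (fun z => a (z.1 - z.2) * b z.2).
Proof.
apply: measurable_funM.
  apply: measurableT_comp => //.
  exact: measurable_funB.
exact: measurableT_comp.
Qed.

(** Young's inequality for two integrable functions is this computation: the
    inner integral does not see the translation by s. *)
Lemma conv_norm_tonelli :
  (\int[mu]_s \int[mu]_t `|(a (t - s) * b s)%R%:E| =
   ((\int[mu]_x `|a x|)%R * (\int[mu]_x `|b x|)%R)%R%:E)%E.
Proof.
under eq_integral => s _.
  rewrite (_ : (fun t => _) = fun t => `|b s|%:E * `|a (t - s)%R|%:E)%E; last first.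
    by apply/funext => t; rewrite -EFinM -normrM mulrC.
  rewrite ge0_integralZl_EFin//; last first.
    apply/measurable_EFinP; apply: measurableT_comp => //.
    apply: measurableT_comp => //.
    exact: measurable_funB.
  rewrite (@ge0_integral_shift (- s) (fun t => `|a t|%:E))//; last first.
    by apply/measurable_EFinP; exact: measurableT_comp.
  rewrite integrable_normE// muleC.
  over.
rewrite ge0_integralZl_EFin//.
- by rewrite integrable_normE.
- by apply/measurable_EFinP; exact: measurableT_comp.
- exact: Rintegral_ge0.
Qed.

Lemma conv_integrand_integrable :
  (mu \x mu)%E.-integrable setT (fun z => (a (z.1 - z.2) * b z.2)%:E).
Proof.
apply/integrable21ltyP.
  by apply/measurable_EFinP; exact: measurable_conv_integrand.
by rewrite conv_norm_tonelli ltry.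
Qed.

(** The convolution of two integrable functions is a genuine integral only
    outside a null set, which is why its algebra below holds almost
    everywhere. *)
Lemma conv_ae_integrable :
  {ae mu, forall t, L1 (fun s => a (t - s) * b s)}.
Proof. exact: (ae_integrable1 conv_integrand_integrable). Qed.

Lemma line_conv_integrable : L1 (line_conv a b).
Proof.
have intF := integrable_fubini_F conv_integrand_integrable.
apply: le_integrable intF => //.
- apply/measurable_EFinP.
  apply: (measurableT_comp (f := fine)) => //.
  by case/integrableP : (integrable_fubini_F conv_integrand_integrable).
- move=> t _; rewrite /line_conv /Rintegral /fubini_F /=.
  by case: (integral _ _ _) => [r| |]/=; rewrite ?leey.
Qed.

Lemma line_conv_norm :
  \int[mu]_t `|line_conv a b t| <= (\int[mu]_x `|a x|) * (\int[mu]_x `|b x|).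
Proof.
rewrite -lee_fin -integrable_normE; last exact: line_conv_integrable.
rewrite -conv_norm_tonelli.
have m1 : measurable_fun setT (fun z : R * R => `|(a (z.1 - z.2) * b z.2)%R%:E|)%E.
  apply: measurableT_comp => //.
  by apply/measurable_EFinP; exact: measurable_conv_integrand.
rewrite -(fubini_tonelli (m1 := mu) (m2 := mu)
  (fun z : R * R => `|(a (z.1 - z.2) * b z.2)%R%:E|)%E)//.
apply: ge0_le_integral => //.
- apply/measurable_EFinP; apply: measurableT_comp => //.
  by have /integrableP[/measurable_EFinP] := line_conv_integrable.
- exact: (measurable_fun_fubini_tonelli_F (m2 := mu) _ m1 (fun z => abse_ge0 _)).
- move=> t _; rewrite /line_conv /Rintegral.
  apply: le_trans; last first.
    apply: le_abse_integral => //.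
    apply/measurable_EFinP; apply: measurable_funM => //.
    apply: measurableT_comp => //.
    by move=> /=; exact: measurable_funB.
  by case: (integral _ _ _) => [r| |]/=; rewrite ?leey.
Qed.

End ConvolutionL1.

Lemma line_convB a b b' : L1 a -> L1 b -> L1 b' ->
  {ae mu, forall t, line_conv a (b \- b') t = line_conv a b t - line_conv a b' t}.
Proof.
move=> inta intb intb'.
apply: filterS2 (conv_ae_integrable inta intb) (conv_ae_integrable inta intb').
move=> t i1 i2; rewrite /line_conv -RintegralB//.
by apply: eq_Rintegral => s _; rewrite mulrBr.
Qed.

End Convolution.

Section NormOnTheLine.
Context {R : realType}.
Local Notation mu := (@lebesgue_measure R).
Local Notation L1 f := (mu.-integrable setT (EFin \o f)).
Local Notation N f := (\int[mu]_x `|f x|).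
Implicit Types (f g h : R -> R) (D : set R).

Lemma restrictE f D x : (f \_ D) x = if x \in D then f x else 0.
Proof. by rewrite patchE. Qed.

Lemma L1_measurable f : L1 f -> measurable_fun setT f.
Proof. by move/integrableP => [/measurable_EFinP]. Qed.

Lemma L1_le f g : measurable_fun setT f -> L1 g ->
  (forall x, `|f x| <= `|g x|) -> L1 f.
Proof.
move=> mf intg fg; apply: le_integrable intg => //; first exact/measurable_EFinP.
by move=> x _ /=; rewrite lee_fin.
Qed.

Lemma L1_restrict f D : measurable D -> L1 f -> L1 (f \_ D).
Proof.
move=> mD intf; apply: L1_le (intf) _.
  by apply/(measurable_restrictT f mD); apply: measurable_funTS; exact: L1_measurable.
by move=> x; rewrite restrictE; case: ifP; rewrite ?normr0.
Qed.

Lemma L1_norm f : L1 f -> L1 (fun x => `|f x|).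
Proof. exact: integrable_norm. Qed.

Lemma L1B f g : L1 f -> L1 g -> L1 (f \- g).
Proof. by move=> intf intg; exact: (integrableB measurableT intf intg). Qed.

Lemma L1D f g : L1 f -> L1 g -> L1 (f \+ g).
Proof. by move=> intf intg; exact: (integrableD measurableT intf intg). Qed.

Lemma ae_le_norm f g : measurable_fun setT f -> L1 g ->
  {ae mu, forall x, `|f x| <= `|g x|} -> N f <= N g.
Proof.
move=> mf intg fg.
have le : (\int[mu]_x `|f x|%:E <= \int[mu]_x `|g x|%:E)%E.
  apply: ae_ge0_le_integral => //.
  - by apply/measurable_EFinP; apply: measurableT_comp.
  - by apply/measurable_EFinP; apply: measurableT_comp => //; exact: L1_measurable.
  - by apply: filterS fg => x fgx _; rewrite lee_fin.
rewrite /Rintegral fine_le//.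
- rewrite ge0_fin_numE ?integral_ge0//.
  by rewrite (le_lt_trans le)// integrable_normE// ltry.
- by rewrite integrable_normE.
Qed.

Lemma norm1_ge0 f : 0 <= N f.
Proof. exact: Rintegral_ge0. Qed.

Lemma norm1_triangle f g : L1 f -> L1 g -> N (f \+ g) <= N f + N g.
Proof.
move=> intf intg; rewrite -RintegralD//; try exact: L1_norm.
apply: le_Rintegral => //.
- by apply: L1_norm; exact: L1D.
- by apply: (@L1D (fun x => `|f x|) (fun x => `|g x|)); exact: L1_norm.
- by move=> x _; exact: ler_normD.
Qed.

Lemma norm1_eq0 f : L1 f -> N f <= 0 -> {ae mu, forall x, f x = 0}.
Proof.
move=> intf Nf.
have {}Nf : N f = 0 by apply/eqP; rewrite eq_le Nf norm1_ge0.
have H : (\int[mu]_x `|(f x)%:E|)%E = 0%E.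
  by under eq_integral do rewrite abse_EFin; rewrite integrable_normE// Nf.
have mf : measurable_fun setT (EFin \o f).
  by apply/measurable_EFinP; exact: L1_measurable.
have /= := (ae_eq_integral_abs mu measurableT mf).1 H.
by apply: filterS => x /(_ Logic.I)/= [].
Qed.

Lemma ae_eq_Rintegral f g : measurable_fun setT f -> measurable_fun setT g ->
  {ae mu, forall x, f x = g x} -> \int[mu]_x f x = \int[mu]_x g x.
Proof.
move=> mf mg fg; congr fine; apply: ae_eq_integral => //.
- exact/measurable_EFinP.
- exact/measurable_EFinP.
- by apply: filterS fg => x ->.
Qed.

(** Everywhere, not just almost everywhere: each value of a convolution is an
    integral of its second argument. *)
Lemma ae_eq_line_conv (a : R -> R) f g : measurable_fun setT a ->
  measurable_fun setT f -> measurable_fun setT g ->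
  {ae mu, forall x, f x = g x} -> line_conv a f =1 line_conv a g.
Proof.
move=> ma mf mg fg t; rewrite /line_conv.
have mat : measurable_fun setT (fun s : R => a (t - s)).
  by apply: measurableT_comp => //; exact: measurable_funB.
apply: ae_eq_Rintegral; try exact: measurable_funM.
by apply: filterS fg => x ->.
Qed.

End NormOnTheLine.

(** * Completeness of L1 *)

Section SeriesL1.
Context {R : realType}.
Local Notation mu := (@lebesgue_measure R).
Local Notation L1 f := (mu.-integrable setT (EFin \o f)).

(** Completeness of L^1 in the form of Riesz and Fischer: the sum G of the
    |u k| is integrable by monotone convergence, so the series converges
    absolutely almost everywhere, and G dominates its partial sums. *)
Lemma L1_series_cvg (u : nat -> R -> R) (M : R) :
  (forall n, L1 (u n)) ->
  (forall n, \sum_(k < n) \int[mu]_x `|u k x| <= M) ->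
  exists2 w : R -> R, L1 w &
    \int[mu]_x `|\sum_(k < n) u k x - w x| @[n --> \oo] --> 0.
Proof.
move=> intu leM.
pose G x : \bar R := (\sum_(0 <= k <oo) `|u k x|%R%:E)%E.
have mu_ k : measurable_fun setT (u k).
  by move/integrableP : (intu k) => [/measurable_EFinP].
have mnu k : measurable_fun setT (fun x => `|u k x|%R%:E).
  by apply/measurable_EFinP; apply: measurableT_comp.
have G0 x : (0 <= G x)%E by apply: nneseries_ge0 => n _ _; rewrite lee_fin.
have mG : measurable_fun setT G.
  by apply: ge0_emeasurable_sum => // k x _ _; rewrite lee_fin.
have intG : mu.-integrable setT G.
  apply/integrableP; split => //.
  under eq_integral do rewrite gee0_abs//.
  rewrite integral_nneseries//.
  apply: le_lt_trans (ltry M).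
  apply: lime_le; first by apply: is_cvg_nneseries => n _ _; exact: integral_ge0.
  apply: nearW => n; rewrite big_mkord.
  under eq_bigr do rewrite integrable_normE//.
  by rewrite sumEFin lee_fin.
pose S n x := \sum_(k < n) u k x.
have mS n : measurable_fun setT (S n) by exact: measurable_sum.
(* the upper limit is measurable and agrees with the sum wherever G is finite *)
pose w' x := limn_esup (fun n => (S n x)%:E).
have mw' : measurable_fun setT w'.
  by apply: measurable_fun_limn_esup => n; exact/measurable_EFinP.
pose w x := fine (w' x).
have cvgS x : (G x < +oo)%E -> S ^~ x @ \oo --> w x.
  move=> Gx.
  have Gfin : G x \is a fin_num by rewrite ge0_fin_numE.
  have cS : cvgn (S ^~ x).
    have -> : S ^~ x = series (u ^~ x).
      by apply/funext => n; rewrite /S /series/= big_mkord.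
    apply: normed_cvg; apply: nondecreasing_is_cvgn.
      apply: (@nondecreasing_series _ (fun k => `|u k x|) xpredT) => n _ _.
      exact: normr_ge0.
    exists (fine (G x)) => _ [n _ <-].
    rewrite -lee_fin fineK// /series/= -sumEFin.
    by apply: nneseries_lim_ge => k _ _; rewrite lee_fin.
  suff -> : w x = limn (S ^~ x) by exact: cS.
  have cE : (S n x)%:E @[n --> \oo] --> (limn (S ^~ x))%:E.
    by apply: cvg_EFin; [exact: nearW|exact: cS].
  rewrite /w /w' is_cvg_limn_esupE; last by apply/cvg_ex; eexists; exact: cE.
  by rewrite (cvg_lim _ cE).
have [iw cw _] : [/\ mu.-integrable setT (EFin \o w),
    (\int[mu]_x `|(S n x)%:E - (w x)%:E|)%E @[n --> \oo] --> 0%E &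
    (\int[mu]_x (S n x)%:E)%E @[n --> \oo] --> (\int[mu]_x (w x)%:E)%E].
  apply: (@dominated_convergence _ _ _ mu setT _ (fun n x => (S n x)%:E) _ G).
  - by [].
  - by move=> n; apply/measurable_EFinP; exact: mS.
  - by apply/measurable_EFinP; apply: measurableT_comp.
  - have := integrable_ae measurableT intG.
    apply: filterS => x /= /(_ Logic.I); rewrite ge0_fin_numE// => Gx _.
    by apply: cvg_EFin; [exact: nearW|exact: cvgS].
  - by [].
  - apply: aeW => x n _.
    rewrite /S abse_EFin (le_trans (y := (\sum_(k < n) `|u k x|)%:E))//.
      by rewrite lee_fin ler_norm_sum.
    rewrite -sumEFin -(big_mkord xpredT (fun k => `|u k x|%:E)).
    by apply: nneseries_lim_ge => k _ _; rewrite lee_fin.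
exists w => //.
exact: (fine_cvg cw).
Qed.

End SeriesL1.

(** * Equations with a contracting convolution kernel *)

Section Contraction.
Context {R : realType}.
Local Notation mu := (@lebesgue_measure R).
Local Notation L1 f := (mu.-integrable setT (EFin \o f)).
Local Notation N f := (\int[mu]_x `|f x|).
Variables (a : R -> R) (D : set R).
Hypotheses (inta : L1 a) (Na : N a <= 2^-1) (mD : measurable D).

(** Young's inequality gives ||p|| <= ||a|| ||p|| <= ||p|| / 2 in L^1. *)
Lemma conv_subsolution_eq0 (p : R -> R) : L1 p -> (forall t, 0 <= p t) ->
  {ae mu, forall t, p t <= line_conv (fun x => `|a x|) p t} ->
  {ae mu, forall t, p t = 0}.
Proof.
move=> intp p0 ple; have intna := L1_norm inta.
have mp := L1_measurable intp.
apply: norm1_eq0 => //.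
have le1 : N p <= N (fun x => `|a x|) * N p.
  apply: le_trans (line_conv_norm intna intp).
  apply: ae_le_norm => //; first exact: line_conv_integrable.
  by apply: filterS ple => t pt; rewrite ger0_norm// (le_trans pt)// ler_norm.
have NaE : N (fun x => `|a x|) = N a.
  by apply: eq_Rintegral => x _; rewrite normr_id.
rewrite NaE in le1.
by have := norm1_ge0 p; have := Na; nra.
Qed.

Section Picard.
Variable f : R -> R.
Hypothesis intf : L1 f.

Let Phi (v : R -> R) := (f \- line_conv a v) \_ D.

Let L1_Phi (v : R -> R) : L1 v -> L1 (Phi v).
Proof.
by move=> intv; apply: L1_restrict => //; apply: L1B => //; exact: line_conv_integrable.
Qed.

Let Phi_contraction (v w : R -> R) : L1 v -> L1 w -> N (Phi v \- Phi w) <= 2^-1 * N (v \- w).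
Proof.
move=> intv intw.
have intvw := L1B intw intv.
have : N (Phi v \- Phi w) <= N (line_conv a (w \- v)).
  apply: ae_le_norm.
  - by apply: L1_measurable; apply: L1B; exact: L1_Phi.
  - exact: line_conv_integrable.
  apply: filterS (line_convB inta intw intv) => t ->.
  rewrite /= /Phi !restrictE; case: ifP => _; last by rewrite subrr normr0.
  by rewrite [X in `|X|](_ : _ = line_conv a w t - line_conv a v t)//=; ring.
move=> /le_trans; apply; apply: le_trans (line_conv_norm inta intvw) _.
have -> : N (w \- v) = N (v \- w) by apply: eq_Rintegral => t _; rewrite /= distrC.
by apply: ler_wpM2r => //; exact: norm1_ge0.
Qed.

(** Picard iteration.  Its limit w satisfies the equation almost everywhere
    only, but the next iterate Phi w satisfies it everywhere, because a
    convolution does not change when its argument changes on a null set. *)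
Lemma conv_fixpoint : exists2 u : R -> R, L1 u &
  forall t, u t = if t \in D then f t - line_conv a u t else 0.
Proof.
pose s n := iter n Phi (cst 0).
have ints n : L1 (s n).
  elim: n => [|n IHn]; last exact: L1_Phi.
  exact: (integrable0 mu setT).
pose d n := s n.+1 \- s n.
have intd n : L1 (d n) by apply: L1B.
have Nd n : N (d n) <= 2^-1 ^+ n * N (d 0%N).
  elim: n => [|n IHn]; first by rewrite expr0 mul1r.
  rewrite (le_trans (Phi_contraction (ints n.+1) (ints n)))// exprS -mulrA.
  by rewrite ler_pM2l.
have sE n x : \sum_(k < n) d k x = s n x.
  elim: n => [|n IHn]; first by rewrite big_ord0.
  by rewrite big_ord_recr/= IHn /d/= addrC subrK.
have leM n : \sum_(k < n) N (d k) <= 2 * N (d 0%N).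
  suff : \sum_(k < n) N (d k) <= (2 - 2 * 2^-1 ^+ n) * N (d 0%N).
    move=> /le_trans; apply; apply: ler_wpM2r; first exact: norm1_ge0.
    by rewrite gerBl// mulr_ge0// exprn_ge0.
  elim: n => [|n IHn]; first by rewrite big_ord0 expr0 mulr1 subrr mul0r.
  rewrite big_ord_recr/= (le_trans (lerD IHn (Nd n)))// -mulrDl.
  apply: ler_wpM2r; first exact: norm1_ge0.
  by rewrite exprS mulrA divff// mul1r; lra.
have [w intw cw] := L1_series_cvg intd leM.
have {}cw : N (s n \- w) @[n --> \oo] --> 0.
  move: cw; apply: cvg_trans; apply: near_eq_cvg; apply: nearW => n /=.
  by apply: eq_Rintegral => x _; rewrite sE.
have intPw := L1_Phi intw.
have wE : {ae mu, forall t, (Phi w \- w) t = 0}.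
  apply: norm1_eq0; first exact: L1B.
  have cw1 : N (s n.+1 \- w) @[n --> \oo] --> 0.
    by rewrite (cvg_shiftS (fun n => N (s n \- w))).
  (* the bound of N (Phi w - w) through the iterate s n.+1, by the triangle
   inequality and contraction *)
  have cc : 2^-1 * N (s n \- w) + N (s n.+1 \- w) @[n --> \oo] --> 0.
    rewrite -[X in _ --> X](addr0 0) -[X in _ --> X + _](mulr0 (2^-1 : R)).
    by apply: cvgD => //; apply: cvgMr.
  apply: (cvgr_to_ge cc); apply: nearW => n.
  apply: (@le_trans _ _ (N (Phi w \- s n.+1) + N (s n.+1 \- w))).
    have := norm1_triangle (L1B intPw (ints n.+1)) (L1B (ints n.+1) intw).
    apply: le_trans; rewrite le_eqVlt; apply/orP; left; apply/eqP.
    by apply: eq_Rintegral => x _ /=; rewrite addrA subrK.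
  rewrite lerD2r.
  have -> : N (Phi w \- s n.+1) = N (s n.+1 \- Phi w).
    by apply: eq_Rintegral => t _; rewrite /= distrC.
  exact: Phi_contraction.
exists (Phi w) => // t.
rewrite {1}/Phi restrictE; case: ifP => // _ /=; congr (_ - _).
apply: ae_eq_line_conv; try exact: L1_measurable.
by apply: filterS wE => x /= /eqP; rewrite subr_eq0 => /eqP.
Qed.

End Picard.

Section FixpointBounds.
Variables (f u : R -> R).
Hypotheses (intf : L1 f) (intu : L1 u).
Hypothesis uE :
  {ae mu, forall t, u t = if t \in D then f t - line_conv a u t else 0}.

Lemma fixpoint_norm_le : N u <= 2 * N f.
Proof.
have intc := line_conv_integrable inta intu.
have : N u <= N (f \- line_conv a u).
  apply: ae_le_norm; [exact: L1_measurable|exact: L1B|].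
  by apply: filterS uE => t ->; case: ifP => // _; rewrite normr0.
have : N (f \- line_conv a u) <= N f + N (line_conv a u).
  have -> : N (line_conv a u) = N (fun t => - line_conv a u t).
    by apply: eq_Rintegral => t _; rewrite normrN.
  apply: (@norm1_triangle _ f (fun t => - line_conv a u t)) => //.
  exact: (integrableN intc).
have := line_conv_norm inta intu; have := norm1_ge0 u; have := Na.
set x := N u; set y := N f; set z := N (line_conv a u); set w := N (f \- _).
by nra.
Qed.

(** The excess p = (|u| - 2 B)^+ is a subsolution: |u| <= p + 2 B gives
    |u(t)| <= B + int |a(t - s)| (p(s) + 2 B) ds <= B + (|a| * p)(t) + B,
    where the last B bounds 2 B times the norm of a. *)
Lemma fixpoint_sup_le (B : R) : 0 <= B ->
  {ae mu, forall t, t \in D -> `|f t| <= B} ->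
  {ae mu, forall t, `|u t| <= 2 * B}.
Proof.
move=> B0 fB; have intna := L1_norm inta.
pose p (t : R) : R := Num.max 0 (`|u t| - 2 * B).
have mu_ := L1_measurable intu.
have mna := L1_measurable intna.
have intp : L1 p.
  apply: L1_le (intu) _.
    apply: measurable_maxr => //; apply: measurable_funB => //.
    exact: measurableT_comp.
  move=> t; rewrite /p ger0_norm ?le_max ?lexx// ge_max normr_ge0/= gerBl.
  by rewrite mulr_ge0.
suff : {ae mu, forall t, p t = 0}.
  apply: filterS => t; rewrite /p => pt.
  by rewrite -subr_le0 -pt le_max lexx orbT.
apply: conv_subsolution_eq0 => // [t|]; first by rewrite le_max lexx.
have intnu := L1_norm intu.
have H1 := conv_ae_integrable inta intu.
have H2 := conv_ae_integrable intna intp.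
apply: filterS3 uE fB (filterI H1 H2) => t ut ft [i1 i2].
have mnat : measurable_fun setT (fun s : R => `|a (t - s)|).
  by apply: (measurableT_comp mna); exact: measurable_funB.
have inat : L1 (fun s => `|a (t - s)|).
  apply/integrableP; split; first exact/measurable_EFinP.
  under eq_integral do rewrite /= normr_id.
  rewrite (@ge0_integral_reflect _ t (fun s => `|a s|%:E))//.
    by rewrite integrable_normE// ltry.
  exact/measurable_EFinP.
have natE : \int[mu]_s `|a (t - s)| = N a.
  by rewrite /Rintegral (@ge0_integral_reflect _ t (fun s => `|a s|%:E))//;
    exact/measurable_EFinP.
have pc0 : 0 <= line_conv (fun x => `|a x|) p t.
  by apply: Rintegral_ge0 => s _; rewrite mulr_ge0// le_max lexx.
rewrite {1}/p ge_max pc0/=.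
move: ut; case: ifP => [tD|_] ->; last first.
  by rewrite normr0 (le_trans _ pc0)// sub0r oppr_le0 mulr_ge0.
suff : `|line_conv a u t| <= line_conv (fun x => `|a x|) p t + B.
  have := ft tD; have := ler_normB (f t) (line_conv a u t).
  by lra.
rewrite /line_conv; apply: le_trans (le_normr_Rintegral measurableT i1) _.
apply: (@le_trans _ _ (\int[mu]_s (`|a (t - s)| * p s + 2 * B * `|a (t - s)|))).
  apply: le_Rintegral => //.
  - exact: L1_norm.
  - apply: (@L1D _ (fun s => `|a (t - s)| * p s) (fun s => 2 * B * `|a (t - s)|)) => //.
    exact: (integrableZl measurableT (2 * B) inat).
  move=> s _; rewrite normrM [X in _ <= _ + X]mulrC -mulrDr.
  by apply: ler_wpM2l => //; rewrite -lerBlDr le_max lexx orbT.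
rewrite RintegralD//; last exact: (integrableZl measurableT (2 * B) inat).
rewrite lerD2l RintegralZl// natE.
by rewrite mulrAC mulrC ler_piMr// mulrC -ler_pdivlMr// div1r.
Qed.

End FixpointBounds.

(** The difference of two solutions solves the equation with f = 0. *)
Lemma fixpoint_unique (f u v : R -> R) : L1 u -> L1 v ->
  {ae mu, forall t, u t = if t \in D then f t - line_conv a u t else 0} ->
  {ae mu, forall t, v t = if t \in D then f t - line_conv a v t else 0} ->
  {ae mu, forall t, u t = v t}.
Proof.
move=> intu intv uE vE.
have intuv := L1B intu intv.
suff H : {ae mu, forall t, (u \- v) t = 0}.
  by apply: filterS H => t /= /eqP; rewrite subr_eq0 => /eqP.
apply: norm1_eq0 => //.
have int0 : L1 (cst 0 : R -> R) by exact: (integrable0 mu setT).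
have -> : 0 = 2 * N (cst 0 : R -> R).
  by rewrite /cst; under eq_Rintegral do rewrite normr0; rewrite Rintegral_cst// !mul0r mulr0.
apply: fixpoint_norm_le => //.
apply: filterS3 uE vE (line_convB inta intu intv) => t /= -> -> ->.
by case: ifP => _; rewrite /cst; ring.
Qed.

End Contraction.

(** * Volterra equations of the second kind *)

Section Volterra.
Context {R : realType}.
Local Notation mu := (@lebesgue_measure R).
Local Notation L1 f := (mu.-integrable setT (EFin \o f)).
Local Notation N f := (\int[mu]_x `|f x|).
Variable h : R -> R.
Hypotheses (inth : L1 h) (h_causal : forall x, x <= 0 -> h x = 0).

Let L1_weight (l : R) : 0 <= l -> L1 (fun x => expR (- (l * x)) * h x).
Proof.
move=> l0; apply: L1_le (inth) _.
  apply: measurable_funM; last exact: L1_measurable.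
  apply: (measurableT_comp (@measurable_expR R)).
  by apply: measurable_funN; exact: measurable_funM.
move=> x; have [x0|x0] := leP x 0; first by rewrite h_causal// mulr0 normr0.
rewrite normrM ler_piMl// ger0_norm ?expR_ge0// -expR0 ler_expR oppr_le0.
by rewrite mulr_ge0// ltW.
Qed.

(** Off the origin exp(- l x) h(x) tends to 0 as l grows, and |h| dominates
    it because h lives on the positive half-line. *)
Lemma exists_contracting_weight : exists2 l : R, 0 <= l &
  N (fun x => expR (- (l * x)) * h x) <= 2^-1.
Proof.
pose F (n : nat) (x : R) : R := `|expR (- (n%:R * x)) * h x|.
have mF n : measurable_fun setT (F n).
  apply: measurableT_comp => //; apply: L1_measurable.
  exact: L1_weight.
have cvgF x : F n x @[n --> \oo] --> (0 : R).
  have [x0|x0] := leP x 0.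
    rewrite (_ : F ^~ x = cst 0); first exact: cvg_cst.
    by apply/funext => n; rewrite /F h_causal// mulr0 normr0.
  rewrite (_ : F ^~ x = fun n => expR (- (n%:R * x)) * `|h x|); last first.
    by apply/funext => n; rewrite /F normrM ger0_norm ?expR_ge0.
  have -> : (0 : R) = 0 * `|h x| by rewrite mul0r.
  apply: cvgMl.
  have c1 : (r * x : R) @[r --> +oo] --> +oo by exact: (gt0_cvgMly x0 cvg_id).
  have c2 := @cvg_comp _ _ _ (fun r : R => r * x) (fun y => expR (- y))
    _ _ _ c1 (@cvgr_expR R).
  exact: (@cvg_comp _ _ _ (fun n : nat => n%:R : R)
    (fun r => expR (- (r * x))) _ _ _ cvgr_idn c2).
have [_ _ cF] : [/\ mu.-integrable setT (cst 0%E),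
    (\int[mu]_x `|(F n x)%:E - 0|)%E @[n --> \oo] --> 0%E &
    (\int[mu]_x (F n x)%:E)%E @[n --> \oo] --> (\int[mu]_x (cst 0 x))%E].
  apply: (@dominated_convergence _ _ _ mu setT _
    (fun n x => (F n x)%:E) _ (fun x => `|h x|%:E)) => //.
  - by move=> n; apply/measurable_EFinP; exact: mF.
  - apply: aeW => x _; apply: cvg_EFin; [exact: nearW|exact: cvgF].
  - exact: L1_norm.
  - apply: aeW => x n _; rewrite /F abse_EFin lee_fin normr_id.
    have [x0|x0] := leP x 0; first by rewrite h_causal// mulr0.
    rewrite normrM ler_piMl// ger0_norm ?expR_ge0// -expR0 ler_expR oppr_le0.
    by rewrite mulr_ge0// ltW.
have {}cF : N (fun x => expR (- (n%:R * x)) * h x) @[n --> \oo] --> (0:R).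
  by move: cF; rewrite integral0 => /fine_cvg.
have /cvgrPdist_le/(_ (2^-1)) := cF.
rewrite invr_gt0 ltr0n => /(_ isT)[n _ /(_ n (leqnn _))].
by rewrite sub0r normrN ger0_norm ?norm1_ge0// => Hn; exists n%:R.
Qed.

(** Exponential weights are multiplicative characters, so they pass through a
    convolution. *)
Lemma line_conv_exp (l : R) (u : R -> R) : L1 u ->
  L1 (fun x => expR (- (l * x)) * u x) -> 0 <= l ->
  {ae mu, forall t, line_conv (fun x => expR (- (l * x)) * h x)
    (fun x => expR (- (l * x)) * u x) t = expR (- (l * t)) * line_conv h u t}.
Proof.
move=> intu intv l0; apply: filterS (conv_ae_integrable inth intu) => t it.
rewrite /line_conv -RintegralZl//; apply: eq_Rintegral => s _.
have -> : - (l * t) = - (l * (t - s)) + - (l * s) by ring.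
by rewrite expRD; ring.
Qed.

Variable T : R.
Local Notation D := `]0, T[%classic.

(** The constant is 2 exp(l T): the contraction contributes 2, and undoing the
    weight on ]0, T[ costs at most exp(l T). *)
Lemma volterra_second_kind : exists2 Q : R, 0 < Q &
  forall g : R -> R, L1 g -> exists u : R -> R,
  [/\ L1 u,
      {ae mu, forall t, u t = if t \in D then g t - line_conv h u t else 0},
      forall v : R -> R, L1 v -> (forall t, t \notin D -> v t = 0) ->
        {ae mu, forall t, t \in D -> v t = g t - line_conv h v t} ->
        {ae mu, forall t, v t = u t},
      N u <= Q * N g &
      forall B : R, 0 <= B -> {ae mu, forall t, t \in D -> `|g t| <= B} ->
        {ae mu, forall t, `|u t| <= Q * B}].
Proof.
have [l l0 Na] := exists_contracting_weight.
have inta := L1_weight l0.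
pose w t := expR (- (l * t)).
pose a x := w x * h x.
have mD : measurable D by exact: measurable_itv.
have w0 t : 0 < w t by exact: expR_gt0.
have mw : measurable_fun setT w.
  apply: (measurableT_comp (@measurable_expR R)).
  by apply: measurable_funN; exact: measurable_funM.
have wV t : expR (l * t) * w t = 1 by rewrite /w -expRD subrr expR0.
have inD t : t \in D = (0 < t < T) by rewrite mem_setE in_itv.
have w1 t : t \in D -> w t <= 1.
  rewrite inD => /andP[t0 _]; rewrite -expR0 ler_expR oppr_le0.
  by rewrite mulr_ge0// ltW.
have ew t : t \in D -> expR (l * t) <= expR (l * T).
  by rewrite inD => /andP[_ tT]; rewrite ler_expR ler_wpM2l// ltW.
have L1w (v : R -> R) : L1 v -> (forall t, t \notin D -> v t = 0) ->
    L1 (fun t => w t * v t).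
  move=> intv v0; apply: L1_le (intv) _.
    by apply: measurable_funM => //; exact: L1_measurable.
  move=> t; have [tD|tD] := boolP (t \in D); last by rewrite v0// mulr0.
  by rewrite normrM ler_piMl// ger0_norm ?w1// ltW.
exists (2 * expR (l * T)); first by rewrite mulr_gt0// expR_gt0.
move=> g intg.
pose gD := g \_ D.
have gD0 t : t \notin D -> gD t = 0.
  by move=> tD; rewrite /gD restrictE (negbTE tD).
have intgD : L1 gD by exact: L1_restrict.
pose f t := w t * gD t.
have intf : L1 f by exact: L1w.
have [ul intul ulE] := conv_fixpoint inta Na mD intf.
have ul0 t : t \notin D -> ul t = 0 by move=> tD; rewrite ulE (negbTE tD).
pose u t := expR (l * t) * ul t.
have u0 t : t \notin D -> u t = 0 by move=> tD; rewrite /u ul0// mulr0.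
have mul : measurable_fun setT ul by exact: L1_measurable.
have u_le t : `|u t| <= expR (l * T) * `|ul t|.
  rewrite /u normrM ger0_norm ?expR_ge0//.
  have [tD|tD] := boolP (t \in D); last by rewrite ul0// normr0 !mulr0.
  by rewrite ler_wpM2r// ew.
have intel : L1 (fun t => expR (l * T) * ul t).
  exact: (integrableZl measurableT (expR (l * T)) intul).
have intu : L1 u.
  apply: L1_le intel _.
    apply: measurable_funM => //.
    by apply: (measurableT_comp (@measurable_expR R)); exact: measurable_funM.
  by move=> t; rewrite [leRHS]normrM [`|expR _|]ger0_norm ?expR_ge0.
have wu t : w t * u t = ul t by rewrite /u mulrA (mulrC (w t)) wV mul1r.
have wuE : (fun t => w t * u t) = ul by apply/funext.
(* multiplying by the weight turns the equation with kernel h into the one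
   with the contracting kernel *)
have weighted (v : R -> R) : L1 v -> (forall t, t \notin D -> v t = 0) ->
    {ae mu, forall t, t \in D -> v t = g t - line_conv h v t} ->
    {ae mu, forall t, w t * v t =
       if t \in D then f t - line_conv a (fun x => w x * v x) t else 0}.
  move=> intv v0 vE.
  apply: filterS2 vE (line_conv_exp intv (L1w _ intv v0) l0) => t vt ct.
  case: ifPn => [tD|tD]; last by rewrite v0// mulr0.
  rewrite /f /gD restrictE tD [X in _ - X]ct -/(w t) -mulrBr.
  by congr (_ * _); exact: vt.
have L1wu : L1 (fun t => w t * u t) by rewrite wuE.
have uE : {ae mu, forall t, u t = if t \in D then g t - line_conv h u t else 0}.
  apply: filterS (line_conv_exp intu L1wu l0) => t ct.
  case: ifPn => [tD|/u0//].
  have := ulE t; rewrite tD /f /gD restrictE tD -wu => E.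
  apply: (mulfI (lt0r_neq0 (w0 t))); rewrite E mulrBr; congr (_ - _).
  by rewrite -ct; congr (line_conv _ _ _); rewrite -wuE.
exists u; split => //.
- move=> v intv v0 vE.
  have := fixpoint_unique inta Na (L1w _ intv v0) intul
    (weighted _ intv v0 vE) (aeW mu ulE).
  apply: filterS => t; rewrite -wu => /(mulfI (lt0r_neq0 (w0 t))).
  exact.
- have H1 : N u <= N (fun t => expR (l * T) * ul t).
    apply: ae_le_norm => //; first exact: L1_measurable.
    by apply: aeW => t; rewrite [leRHS]normrM [`|expR _|]ger0_norm ?expR_ge0.
  have H2 : N (fun t => expR (l * T) * ul t) = expR (l * T) * N ul.
    rewrite -RintegralZl//; last exact: L1_norm.
    by apply: eq_Rintegral => t _; rewrite normrM ger0_norm ?expR_ge0.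
  have H3 := fixpoint_norm_le inta Na intf intul (aeW mu ulE).
  have H4 : N f <= N g.
    apply: ae_le_norm => //; first exact: L1_measurable.
    apply: aeW => t; rewrite /f; have [tD|tD] := boolP (t \in D).
      rewrite /gD restrictE tD normrM ler_piMl// ger0_norm ?w1// ltW//.
    by rewrite gD0// mulr0 normr0.
  apply: (le_trans H1); rewrite H2 (mulrC 2) -mulrA ler_wpM2l ?expR_ge0//.
  by rewrite (le_trans H3)// ler_wpM2l.
- move=> B B0 gB.
  have fB : {ae mu, forall t, t \in D -> `|f t| <= B}.
    apply: filterS gB => t gt tD; rewrite /f /gD restrictE tD normrM.
    rewrite (le_trans _ (gt tD))// ler_piMl// ger0_norm ?w1// ltW//.
  have := fixpoint_sup_le inta Na intul (aeW mu ulE) B0 fB.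
  apply: filterS => t ult; rewrite (le_trans (u_le t))//.
  by rewrite (mulrC 2) -mulrA ler_wpM2l ?expR_ge0.
Qed.

End Volterra.

(** * Primitives of convolutions *)

Section PrimitiveIdentity.
Context {R : realType}.
Local Notation mu := (@lebesgue_measure R).
Local Notation L1 f := (mu.-integrable setT (EFin \o f)).

Lemma integral_shift (x0 : R) (f : R -> \bar R) : measurable_fun setT f ->
  (\int[mu]_x f (x + x0)%R = \int[mu]_x f x)%E.
Proof.
move=> mf; rewrite integralE [RHS]integralE.
have ep : (fun x => f (x + x0)%R)^\+%E = (fun x => f^\+%E (x + x0)).
  exact: (funepos_comp f (fun x => x + x0)).
have en : (fun x => f (x + x0)%R)^\-%E = (fun x => f^\-%E (x + x0)).
  exact: (funeneg_comp f (fun x => x + x0)).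
rewrite ep en.
by rewrite (ge0_integral_shift x0 (measurable_funepos mf) (funepos_ge0 f))
  (ge0_integral_shift x0 (measurable_funeneg mf) (funeneg_ge0 f)).
Qed.

Lemma L1_fine (f : R -> \bar R) : mu.-integrable setT f -> L1 (fine \o f).
Proof.
move=> intf; apply: le_integrable (intf) => //.
  apply/measurable_EFinP; apply: (measurableT_comp (f := fine)) => //.
  by case/integrableP : intf.
by move=> x _ /=; case: (f x) => [r| |]/=; rewrite ?leey.
Qed.

Lemma integrable_fubini_G (F : R * R -> \bar R) :
  (mu \x mu)%E.-integrable setT F ->
  mu.-integrable setT (fun y => \int[mu]_x F (x, y))%E.
Proof.
move=> intF.
have mF : measurable_fun setT F by case/integrableP : intF.
have mnF : measurable_fun setT (abse \o F) by exact: measurableT_comp.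
apply/integrableP; split; first exact: (measurable_fubini_G intF).
apply: le_lt_trans ((integrable21ltyP mu mu mF).1 intF).
apply: ge0_le_integral => //.
- by apply: measurableT_comp => //; exact: (measurable_fubini_G intF).
- exact: (measurable_fun_fubini_tonelli_G (m1 := mu) (abse \o F) mnF
    (fun z => abse_ge0 _)).
- move=> y _; apply: le_abse_integral => //.
  by apply: (measurableT_comp mF); exact: pair2_measurable.
Qed.

Lemma Rintegral_fubini (F : R * R -> R) :
  (mu \x mu)%E.-integrable setT (EFin \o F) ->
  \int[mu]_x \int[mu]_y F (x, y) = \int[mu]_y \int[mu]_x F (x, y).
Proof.
move=> intF; rewrite /Rintegral; congr fine.
have i1 := integrable_fubini_F intF.
have i2 := integrable_fubini_G intF.
have e1 : (\int[mu]_x (fine (\int[mu]_y (F (x, y))%:E))%:E =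
           \int[mu]_x \int[mu]_y (F (x, y))%:E)%E.
  apply: ae_eq_integral => //.
  - apply/measurable_EFinP; apply: (measurableT_comp (f := fine)) => //.
    by case/integrableP : i1.
  - by case/integrableP : i1.
  - have := integrable_ae measurableT i1.
    by apply: filterS => x /= /(_ Logic.I) fx _; rewrite fineK.
have e2 : (\int[mu]_y (fine (\int[mu]_x (F (x, y))%:E))%:E =
           \int[mu]_y \int[mu]_x (F (x, y))%:E)%E.
  apply: ae_eq_integral => //.
  - apply/measurable_EFinP; apply: (measurableT_comp (f := fine)) => //.
    by case/integrableP : i2.
  - by case/integrableP : i2.
  - have := integrable_ae measurableT i2.
    by apply: filterS => x /= /(_ Logic.I) fx _; rewrite fineK.
by rewrite e1 e2 (Fubini intF).
Qed.

Variables (T : R) (h k v : R -> R).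
Local Notation D := (`]0%R, T[%classic : set R).
Hypotheses (inth : L1 h) (intv : mu.-integrable D (EFin \o v)).
Hypothesis h_causal : forall x, x <= 0 -> h x = 0.
Hypothesis kE : forall t, t \in `[0, T] ->
  k t = 1 + \int[mu]_(s in `]0, t[) h s.

Lemma L1_restrict_integrable : L1 (v \_ D).
Proof. by rewrite -restrict_EFin; apply/integrable_restrict => //; rewrite setTI. Qed.

(** Exchange the integrals in int_0^t (h * u): the inner integral of h(x - s)
    over x in ]0, t[ is the integral of h over ]0, t - s[, that is k(t - s) - 1,
    and the term u accounts for the 1.  The function v is cut off to ]0, T[ so
    that the convolution over the line makes sense; k * v does not see this,
    the endpoints being null. *)
Lemma primitive_conv (t : R) : t \in `[0, T] ->
  \int[mu]_(s in `]0, t[) ((v \_ D) s + line_conv h (v \_ D) s) = Defs.conv k v t.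
Proof.
have vE x : x \in `]0, T[ -> (v \_ D) x = v x.
  by move=> xD; rewrite restrictE mem_setE xD.
have u0 x : x \notin `]0, T[ -> (v \_ D) x = 0.
  by move=> xD; rewrite restrictE mem_setE (negbTE xD).
move: (v \_ D) L1_restrict_integrable vE u0 => u intu vE u0.
move=> tT.
have mh := L1_measurable inth.
have mu_ := L1_measurable intu.
pose E : set R := `]0, t[%classic.
have mE : measurable E by exact: measurable_itv.
have ED x : x \in E -> x \in `]0, T[.
  move: tT; rewrite mem_setE !in_itv/= => /andP[_ tT] /andP[-> xt].
  exact: lt_le_trans tT.
have intc := line_conv_integrable inth intu.
pose F (z : R * R) := \1_E z.1 * (h (z.1 - z.2) * u z.2).
have intF : (mu \x mu)%E.-integrable setT (EFin \o F).
  apply: le_integrable (conv_integrand_integrable inth intu) => //.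
    apply/measurable_EFinP; apply: measurable_funM.
      by apply: (measurableT_comp (measurable_indic mE)).
    exact: measurable_conv_integrand.
  move=> z _; rewrite lee_fin /F normrM ler_piMl// indicE.
  by case: (_ \in _); rewrite ?normr1 ?normr0.
have inner s : \int[mu]_x F (x, s) = \1_E s * ((k (t - s) - 1) * u s).
  have [s0|s0] := boolP (s \in `]0, T[); last first.
    have F0 x : F (x, s) = 0 by rewrite /F/= (u0 _ s0) !mulr0.
    rewrite (u0 _ s0) !mulr0; under eq_Rintegral do rewrite F0.
    by rewrite Rintegral_cst ?mul0r.
  have mhs : measurable_fun setT (fun x => \1_E x * h (x - s)).
    apply: measurable_funM; first exact: measurable_indic.
    by apply: (measurableT_comp mh); exact: measurable_funB.
  have -> : \int[mu]_x F (x, s) = \int[mu]_x (\1_E x * h (x - s) * u s).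
    by apply: eq_Rintegral => x _; rewrite /F/= mulrA.
  have sh : (\int[mu]_x (\1_E x * h (x - s))%:E =
             \int[mu]_x (\1_E (x + s) * h x)%R%:E)%E.
    rewrite -(integral_shift s); last exact/measurable_EFinP.
    by apply: eq_integral => x _; rewrite addrK.
  have iEs : L1 (fun x => \1_E (x + s) * h x).
    apply: L1_le (inth) _.
      apply: measurable_funM => //.
      by apply: (measurableT_comp (measurable_indic mE)); exact: measurable_funD.
    move=> x; rewrite normrM ler_piMl// indicE.
    by case: (_ \in _); rewrite ?normr1 ?normr0.
  have iE : L1 (fun x => \1_E x * h (x - s)).
    apply/integrableP; split; first exact/measurable_EFinP.
    rewrite -(integral_shift s); last first.
      by apply: measurableT_comp => //; exact/measurable_EFinP.
    under eq_integral do rewrite /= addrK.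
    by case/integrableP : iEs.
  rewrite RintegralZr//.
  have -> : \int[mu]_x (\1_E x * h (x - s)) = \int[mu]_x (\1_E (x + s) * h x).
    by rewrite /Rintegral sh.
  move: s0; rewrite in_itv/= => /andP[s0 sT].
  rewrite mulrA; congr (_ * _).
  have -> : \int[mu]_x (\1_E (x + s) * h x) = \int[mu]_(x in `]0, t - s[) h x.
    rewrite [RHS]Rintegral_mkcond; apply: eq_Rintegral => x _.
    rewrite restrictE indicE !mem_setE !in_itv/= ltrBrDr.
    have [x0|x0] := leP x 0; first by rewrite h_causal// mulr0.
    by rewrite addr_gt0//=; case: ifP => _; rewrite ?mul1r ?mul0r.
  rewrite indicE mem_setE in_itv/= s0/=.
  move: tT; rewrite in_itv/= => /andP[t0 tT].
  have [st|st] := ltP s t.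
    rewrite mul1r kE; first by rewrite [1 + _]addrC addrK.
    by rewrite in_itv/= subr_ge0 (ltW st)/= lerBlDr (le_trans tT)// lerDl ltW.
  rewrite mul0r set_itv_ge ?Rintegral_set0//.
  by rewrite bnd_simp -leNgt subr_le0.
have c1 : \int[mu]_(s in E) line_conv h u s = \int[mu]_x \int[mu]_y F (x, y).
  rewrite Rintegral_mkcond; apply: eq_Rintegral => x _.
  rewrite restrictE /F /= indicE; case: ifP => xE.
    by apply: eq_Rintegral => s _; rewrite mul1r.
  by under eq_Rintegral do rewrite mul0r; rewrite Rintegral_cst// mul0r.
have c2 : \int[mu]_(s in E) line_conv h u s =
          \int[mu]_s (\1_E s * ((k (t - s) - 1) * u s)).
  by rewrite c1 (Rintegral_fubini intF); apply: eq_Rintegral => s _; exact: inner.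
have intI : L1 (fun s => \1_E s * ((k (t - s) - 1) * u s)).
  apply: eq_integrable (L1_fine (integrable_fubini_G intF)) => // s _.
  by rewrite /= -inner.
have intuE : L1 (fun s => \1_E s * u s).
  apply: L1_le (intu) _.
    by apply: measurable_funM => //; exact: measurable_indic.
  move=> x; rewrite normrM ler_piMl// indicE.
  by case: (_ \in _); rewrite ?normr1 ?normr0.
have splitE : \int[mu]_(s in E) (u s + line_conv h u s) =
    \int[mu]_(s in E) u s + \int[mu]_(s in E) line_conv h u s.
  by apply: RintegralD; [exact: mE|
    exact: (@integrableS _ _ _ mu setT E _ measurableT mE (@subsetT _ E) intu)|
    exact: (@integrableS _ _ _ mu setT E _ measurableT mE (@subsetT _ E) intc)].
have uE : \int[mu]_(s in E) u s = \int[mu]_s (\1_E s * u s).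
  rewrite Rintegral_mkcond; apply: eq_Rintegral => x _.
  by rewrite restrictE indicE; case: ifP => _; rewrite ?mul1r ?mul0r.
rewrite splitE c2 uE -RintegralD; [|exact: measurableT|exact: intuE|exact: intI].
have sumE : \int[mu]_s (\1_E s * u s + \1_E s * ((k (t - s) - 1) * u s)) =
    \int[mu]_(s in E) (k (t - s) * v s).
  rewrite [RHS]Rintegral_mkcond; apply: eq_Rintegral => x _.
  rewrite restrictE indicE; case: ifP => [xE|_] /=; last by rewrite !mul0r addr0.
  by rewrite -(vE x (ED x xE)); ring.
rewrite sumE /Defs.conv /Rintegral (@integral_itv_bndoo _ 0 t _ true false)//.
apply/measurable_EFinP/(measurable_restrictT _ mE).
have := L1_measurable (L1D intuE intI).
congr measurable_fun; apply/funext => x /=.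
rewrite restrictE indicE; case: ifP => [xE|_] /=; last by rewrite !mul0r addr0.
by rewrite -(vE x (ED x xE)); ring.
Qed.

End PrimitiveIdentity.

Section ZeroPrimitive.
Context {R : realType}.
Local Notation mu := (@lebesgue_measure R).
Local Notation L1 f := (mu.-integrable setT (EFin \o f)).

(** The Lebesgue differentiation theorem recovers w from its primitive. *)
Lemma primitive_eq0_ae (T : R) (w : R -> R) : L1 w ->
  (forall t, t \in `[0, T] -> \int[mu]_(s in `]0, t[) w s = 0) ->
  {ae mu, forall t, t \in `]0, T[ -> w t = 0}.
Proof.
move=> intw w0.
have locw : locally_integrable setT w.
  by apply: open_integrable_locally => //; exact: openT.
have intS y : mu.-integrable [set` Interval (BRight 0) (BRight y)] (EFin \o w).
  by apply: (integrableS measurableT) => //; exact: intw.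
have := FTC1 intS locw.
apply: filterS => x /= H; rewrite in_itv/= => /andP[x0 xT].
have [] := H; first by rewrite lte_fin.
move=> _ <-.
rewrite derive1E.
rewrite (near_eq_derive (g := cst 0)) ?derive_cst ?oner_neq0//.
near=> y.
rewrite /cst -[RHS](w0 y); last first.
  by rewrite in_itv/=; apply/andP; split; apply: ltW; near: y;
    [exact: lt_nbhsr|exact: lt_nbhsl].
rewrite (_ : \int[mu]_(s in `]0, y[) w s = \int[mu]_(s in `]0, y]) w s)//.
apply: Rintegral_itv_bndo_bndc.
by apply: (integrableS measurableT) => //; exact: intw.
Unshelve. all: by end_near. Qed.

End ZeroPrimitive.

(** * The fundamental theorem with an integrable singularity *)

Section ImproperFTC.
Context {R : realType}.
Local Notation mu := (@lebesgue_measure R).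
Variables (T : R) (F g : R -> R).
Hypotheses (T0 : 0 < T).
Hypotheses (cF : {within `[0, T], continuous F}).
Hypotheses (dF : forall x, x \in `]0, T[ -> is_derive x 1 F (g x)).
Hypotheses (cg : forall x, x \in `]0, T[ -> {for x, continuous g}).

Lemma continuous_oo_measurable : measurable_fun `]0, T[ g.
Proof.
apply: open_continuous_measurable_fun; first exact: interval_open.
by move=> x; rewrite inE => xT; exact: cg.
Qed.

(** The derivative g may blow up at both ends of ]0, T[.  The primitive of g is
    still continuous on [0, T] and has derivative g inside, so F minus this
    primitive is constant by the mean value theorem. *)
Lemma improper_FTC : mu.-integrable `]0, T[ (EFin \o g) ->
  forall t, t \in `[0, T] -> F t = F 0 + \int[mu]_(s in `]0, t[) g s.
Proof.
move=> intg t; rewrite in_itv/= le_eqVlt => /andP[/predU1P[<- _|t0 tT]].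
  by rewrite set_itvoo0 Rintegral_set0 addr0.
pose g0 := g \_ `]0, T[.
have mI (a b : R) : measurable (`]a, b[%classic : set R) by exact: measurable_itv.
have intg0 : mu.-integrable setT (EFin \o g0).
  by rewrite /g0 -restrict_EFin; apply/integrable_restrict => //; rewrite setTI.
have intS (D : set R) : measurable D -> mu.-integrable D (EFin \o g0).
  by move=> mD; apply: (integrableS measurableT) => //.
pose P x := \int[mu]_(s in `[0, x]) g0 s.
have cP : {within `[0, T], continuous P}.
  apply: (parameterized_integral_continuous (ltW T0)).
  by apply: intS; exact: measurable_itv.
have dP x : x \in `]0, T[ -> is_derive x 1 P (g x).
  move=> xT; have := xT; rewrite in_itv/= => /andP[x0 xltT].
  have cg0 : {for x, continuous g0}.
    have : {near x, g =1 g0}.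
      near=> y; rewrite /g0 patchE ifT// inE/=.
      by near: y; exact: near_in_itvoo.
    move=> /[dup] H /near_eq_cvg cgg; rewrite /prop_for /continuous_at.
    by rewrite -(nbhs_singleton H); apply: cvg_trans cgg (cg xT).
  have [d1 d2] := continuous_FTC1_closed xltT
     (intS _ (@measurable_itv _ `[0, T])) x0 cg0.
  split => //.
  by rewrite -derive1E d2 /g0 patchE mem_set.
have cFP : {within `[0, t], continuous (F \- P)}.
  apply: (@continuous_subspaceW _ _ _ `[0, T]).
    by apply: subset_itvl; rewrite bnd_simp.
  move=> x; apply: continuousB; [exact: cF|exact: cP].
have dFP x : x \in `]0, t[ -> is_derive x 1 (F \- P) (0 : R).
  rewrite in_itv/= => /andP[x0 xt].
  have xT : x \in `]0, T[ by rewrite in_itv/= x0 (lt_le_trans xt).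
  rewrite -(subrr (g x)).
  by apply: is_deriveB; [exact: dF|exact: dP].
have [c _] := MVT t0 dFP cFP.
rewrite mul0r => /eqP; rewrite subr_eq0 => /eqP /=.
have P0 : P 0 = 0 by rewrite /P set_itv1 Rintegral_set1.
rewrite P0 subr0 => <-.
rewrite -[LHS](subrK (P t)); congr (_ + _).
rewrite /P /Rintegral (@integral_itv_bndoo _ 0 t _ true false); last first.
  exact: (measurable_int mu (intS _ (mI _ _))).
congr fine; apply: eq_integral => s; rewrite inE/= in_itv/= => /andP[s0 st].
by rewrite /g0 patchE mem_set//= in_itv/= s0 (lt_le_trans st).
Unshelve. all: by end_near. Qed.

End ImproperFTC.

Section Powers.
Context {R : realType}.
Local Notation mu := (@lebesgue_measure R).

Lemma continuous_powR (p x : R) : 0 < x -> {for x, continuous (fun y => y `^ p)}.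
Proof.
move=> x0; apply: differentiable_continuous; apply/derivable1_diffP.
by apply: ex_derive; exact: is_derive1_powR.
Qed.

(** Exhaust ]0, 1] by the intervals [1 / (n + 1), 1], on which the integral is
    at most 1 / q. *)
Lemma integrable_powR_oc01 (q : R) : 0 < q ->
  mu.-integrable `]0, 1] (EFin \o (fun x => x `^ (q - 1))).
Proof.
move=> q0.
pose I (n : nat) : set R := `[n.+1%:R^-1, 1]%classic.
have In n : 0 < n.+1%:R^-1 :> R by rewrite invr_gt0.
have mp (D : set R) : measurable_fun D (fun x : R => (x `^ (q - 1))%:E).
  by apply/measurable_EFinP; apply: measurable_funTS; exact: measurable_powR.
have UI : \bigcup_n I n = `]0, 1]%classic.
  apply/seteqP; split => x /=.
    by move=> [n _]; rewrite /I/= !in_itv/= => /andP[xn ->]; rewrite (lt_le_trans (In n) xn).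
  rewrite in_itv/= => /andP[x0 x1].
  exists (Num.trunc x^-1) => //; rewrite /I/= in_itv/= x1 andbT.
  rewrite -[leRHS]invrK lef_pV2 ?posrE ?invr_gt0//; apply: ltW.
  by have := truncnS_gt x^-1.
have cvgI := @ge0_nondecreasing_set_cvg_integral _ (measurableTypeR R) R I
  (fun x : R => (x `^ (q - 1))%:E) mu.
have leI n : (\int[mu]_(x in I n) (x `^ (q - 1))%:E <= (q^-1)%:E)%E.
  rewrite /I; have := In n; set a : R := n.+1%:R^-1 => a0.
  have : a <= 1 by rewrite invf_le1// ler1n.
  rewrite le_eqVlt => /predU1P[->|a1].
    by rewrite set_itv1 integral_set1 lee_fin invr_ge0 ltW.
  rewrite (@continuous_FTC2 _ _ (fun x => q^-1 * x `^ q))//.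
  - rewrite -EFinB lee_fin powR1 mulr1 gerBl mulr_ge0 ?powR_ge0// invr_ge0 ltW//.
  - apply: continuous_in_subspaceT => x; rewrite inE/= in_itv/= => /andP[ax _].
    exact/continuous_powR/(lt_le_trans a0).
  - have dF x : 0 < x -> derivable (fun x => q^-1 * x `^ q) x 1.
      by move=> x0; apply: derivableM => //; apply: ex_derive; exact: is_derive1_powR.
    have cF x : 0 < x -> {for x, continuous (fun x => q^-1 * x `^ q)}.
      by move=> x0; apply: differentiable_continuous; apply/derivable1_diffP; exact: dF.
    split.
    + by move=> x; rewrite in_itv/= => /andP[ax _]; exact/dF/(lt_trans a0).
    + by apply: cvg_at_right_filter; exact: cF.
    + by apply: cvg_at_left_filter; exact: cF.
  - move=> x; rewrite in_itv/= => /andP[ax _].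
    have x0 := lt_trans a0 ax.
    rewrite derive1Ml; last by apply: ex_derive; exact: is_derive1_powR.
    by rewrite powR_derive1 ?in_itv/= ?x0// mulrA mulVf ?gt_eqF// mul1r.
apply/integrableP; split; first exact: mp.
under eq_integral do rewrite gee0_abs ?lee_fin ?powR_ge0//.
rewrite -UI; apply: le_lt_trans (ltry q^-1).
apply: cvge_to_le (cvgI _ _ _ _) _.
- apply/nondecreasing_seqP => n; rewrite subsetEset; apply: subset_itvr.
  by rewrite bnd_simp lef_pV2 ?posrE// ler_nat.
- by move=> n; exact: measurable_itv.
- by move=> n; exact: mp.
- by move=> n x _; rewrite lee_fin powR_ge0.
- exact: nearW.
Qed.

End Powers.

(** * Regularity of the Gamma function *)

Section GammaRegularity.
Context {R : realType}.
Local Notation mu := (@lebesgue_measure R).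
Local Notation half_line := (`]0%R, +oo[%classic : set R).

Lemma integrable_exp_half : mu.-integrable half_line (EFin \o (fun t => expR (- (t / 2)))).
Proof.
have m1 (D : set R) : measurable_fun D (EFin \o (fun t : R => expR (- (t / 2)))).
  apply/measurable_EFinP; apply: measurable_funTS.
  apply: (measurableT_comp (@measurable_expR R)).
  by apply: measurable_funN; exact: measurable_funM.
have dF (x : R) : is_derive x 1 (fun t => - 2 * expR (- (t / 2))) (expR (- (x / 2))).
  apply: is_derive_eq.
  rewrite /GRing.scale/=; by field.
apply: (@integrableS _ _ _ mu `[0, +oo[) => //.
  by apply: subset_itvr; rewrite bnd_simp.
apply/integrableP; split; first exact: m1.
under eq_integral do rewrite gee0_abs ?lee_fin ?expR_ge0//.
rewrite (@ge0_continuous_FTC2y _ _ (fun t => - 2 * expR (- (t / 2))) 0 0)//.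
- by rewrite -EFinB ltry.
- apply: continuous_in_subspaceT => x _.
  apply: differentiable_continuous; apply/derivable1_diffP.
  exact: ex_derive.
- have -> : (0 : R) = - 2 * 0 by rewrite mulr0.
  apply: cvgMr.
  have c1 : (r / 2 : R) @[r --> +oo] --> +oo.
    by apply: gt0_cvgMly; [rewrite invr_gt0|exact: cvg_id].
  exact: (@cvg_comp _ _ _ (fun r : R => r / 2) (fun y => expR (- y))
    _ _ _ c1 (@cvgr_expR R)).
- have c0 : {for 0, continuous (fun t : R => - 2 * expR (- (t / 2)))}.
    apply: differentiable_continuous; apply/derivable1_diffP.
    exact: (@ex_derive _ _ _ _ _ _ _ (dF 0)).
  exact: cvg_at_right_filter c0.
- by move=> x x0; rewrite derive1E derive_val.
Qed.

Definition gamma_integrand (x t : R) := t `^ (x - 1) * expR (- t).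
Definition gamma_dintegrand (x t : R) := ln t * t `^ (x - 1) * expR (- t).
(** One integrable majorant, for all x in ]2 q, 2[, of the integrand of Gamma
    and of its derivative in x.  On ]0, 1] the power t^(x - 1) is at most
    t^(2 q - 1), and the spare factor t^q absorbs q |ln t|.  On ]1, +oo[ the
    factors in front of exp(- t) are at most t^2, which half of the exponential
    absorbs up to the constant 16. *)
Definition gamma_dominator (q t : R) :=
  q^-1 * (t `^ (q - 1) * \1_(`]0, 1]%classic) t) + 16 * expR (- (t / 2)).

Lemma integrable_gamma_dominator (q : R) : 0 < q ->
  mu.-integrable half_line (EFin \o gamma_dominator q).
Proof.
move=> q0.
have m0 : measurable half_line by exact: measurable_itv.
apply: (@integrableD _ _ _ mu half_line m0
  (fun t => (q^-1 * (t `^ (q - 1) * \1_(`]0, 1]%classic) t))%:E)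
  (fun t => (16 * expR (- (t / 2)))%:E)).
  apply: (@integrableZl _ _ _ mu half_line m0 q^-1
    (fun t => (t `^ (q - 1) * \1_(`]0, 1]%classic) t)%:E)).
  have m1 : measurable (`]0%R, 1%R]%classic : set R) by exact: measurable_itv.
  have := (integrable_restrict mu m1 m0
    (EFin \o (fun t => t `^ (q - 1)))).1.
  rewrite (_ : half_line `&` `]0, 1] = `]0, 1]%classic); last first.
    by apply/setIidr; apply: subset_itvl.
  move=> /(_ (integrable_powR_oc01 q0)); apply: eq_integrable => // t _.
  by rewrite patchE /= indicE; case: ifP => _; rewrite ?mulr1 ?mulr0.
apply: (@integrableZl _ _ _ mu half_line m0 16
    (fun t => (expR (- (t / 2)))%:E)); exact: integrable_exp_half.
Qed.

Lemma gamma_dominator_ge0 (q t : R) : 0 < q -> 0 <= gamma_dominator q t.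
Proof.
move=> q0; apply: addr_ge0; last by apply: mulr_ge0; rewrite ?expR_ge0.
by rewrite mulr_ge0 ?invr_ge0 ?(ltW q0)// mulr_ge0 ?powR_ge0.
Qed.

(** From t / 4 <= exp(t / 4), squared. *)
Lemma sqr_expN_le (t : R) : 0 <= t -> t * t * expR (- t) <= 16 * expR (- (t / 2)).
Proof.
move=> t0.
have e4 : t / 4 <= expR (t / 4).
  by apply: le_trans (expR_ge1Dx (t / 4)); rewrite lerDr.
have -> : expR (- t) = expR (- (t / 2)) * (expR (t / 4))^-1 ^+ 2.
  by rewrite -expRN -expRM_natl -expRD; congr expR; field.
have e0 : 0 < expR (t / 4) by exact: expR_gt0.
set x := expR (t / 4) in e4 e0 *.
rewrite mulrCA [leRHS]mulrC ler_wpM2l ?expR_ge0//.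
rewrite exprVn ler_pdivrMr ?exprn_gt0//.
have : t <= 4 * x by lra.
by move=> tx; nra.
Qed.

Section Bounds.
Variables (q y t : R).
Hypotheses (q0 : 0 < q) (q1 : q < 1) (qy : 2 * q < y) (y2 : y < 2) (t0 : 0 < t).

Lemma powR_le_small : t <= 1 -> t `^ (y - 1) <= t `^ (2 * q - 1).
Proof. by move=> t1; apply: ger_powR; rewrite ?t0// lerD2r ltW. Qed.

Lemma powR_le_large : 1 <= t -> t `^ (y - 1) <= t.
Proof.
by move=> t1; have := @ler_powR _ t t1 (y - 1) 1; rewrite (powRr1 (ltW t0)); apply; have := y2; lra.
Qed.

Lemma gamma_integrand_le : `|gamma_integrand y t| <= gamma_dominator q t.
Proof.
rewrite ger0_norm ?mulr_ge0 ?powR_ge0 ?expR_ge0// /gamma_integrand /gamma_dominator.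
rewrite indicE mem_setE in_itv/= t0/=.
have [t1|t1] := leP t 1.
  rewrite mulr1 -[leLHS]addr0 lerD ?mulr_ge0 ?expR_ge0//.
  apply: (@le_trans _ _ (t `^ (2 * q - 1))).
    rewrite (le_trans _ (powR_le_small t1))// ler_piMr ?powR_ge0// -expR0 ler_expR.
    by rewrite oppr_le0 ltW.
  apply: (@le_trans _ _ (t `^ (q - 1))).
    by apply: ger_powR; rewrite ?t0//; have := q0; lra.
  by rewrite ler_peMl ?powR_ge0// invf_ge1// ltW.
rewrite mulr0 mulr0 add0r; apply: le_trans (sqr_expN_le (ltW t0)).
rewrite ler_wpM2r ?expR_ge0// (le_trans (powR_le_large (ltW t1)))//.
by rewrite ler_peMl// ltW.
Qed.

Lemma gamma_dintegrand_le : `|gamma_dintegrand y t| <= gamma_dominator q t.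
Proof.
rewrite /gamma_dintegrand /gamma_dominator !normrM.
rewrite [`|_ `^ _|]ger0_norm ?powR_ge0// [`|expR _|]ger0_norm ?expR_ge0//.
rewrite indicE mem_setE in_itv/= t0/=.
have [t1|t1] := leP t 1.
  rewrite mulr1 -[leLHS]addr0 lerD ?mulr_ge0 ?expR_ge0//.
  apply: (@le_trans _ _ (`|ln t| * t `^ (2 * q - 1))).
    rewrite (@le_trans _ _ (`|ln t| * t `^ (y - 1)))//.
      rewrite ler_piMr ?mulr_ge0 ?powR_ge0// -expR0 ler_expR.
      by rewrite oppr_le0 ltW.
    by rewrite ler_wpM2l// powR_le_small.
  have -> : t `^ (q - 1) = t `^ (- q) * t `^ (2 * q - 1).
    rewrite -powRD; last by rewrite (gt_eqF t0)/= implybT.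
    by congr (t `^ _); ring.
  rewrite mulrA ler_wpM2r ?powR_ge0// ler_pdivlMl//.
  rewrite ler0_norm ?ln_le0// /powR gt_eqF//.
  apply: le_trans (expR_ge1Dx _).
  by rewrite mulrN mulNr lerDr.
rewrite mulr0 mulr0 add0r; apply: le_trans (sqr_expN_le (ltW t0)).
rewrite ler_wpM2r ?expR_ge0//; apply: ler_pM => //; rewrite ?powR_ge0//.
  rewrite ger0_norm ?ln_ge0 ?(ltW t1)//.
  have := @le_ln1Dx R (t - 1).
  by rewrite [1 + _]addrC subrK => H; apply: (le_trans (H _)); lra.
exact/powR_le_large/ltW.
Qed.

End Bounds.

Lemma measurable_gamma_integrand (x : R) (D : set R) :
  measurable_fun D (gamma_integrand x).
Proof.
apply: measurable_funTS; apply: measurable_funM; first exact: measurable_powR.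
by apply: (measurableT_comp (@measurable_expR R)); exact: measurable_funN.
Qed.

Lemma measurable_gamma_dintegrand (x : R) (D : set R) :
  measurable_fun D (gamma_dintegrand x).
Proof.
apply: measurable_funTS; apply: measurable_funM.
  by apply: measurable_funM; [exact: measurable_ln|exact: measurable_powR].
by apply: (measurableT_comp (@measurable_expR R)); exact: measurable_funN.
Qed.

(** In x the integrand is an exponential with rate ln t. *)
Lemma is_derive_gamma_integrand (t x : R) : 0 < t ->
  is_derive x 1 (gamma_integrand ^~ t) (gamma_dintegrand x t).
Proof.
move=> t0.
have -> : gamma_integrand ^~ t = fun x => expR ((x - 1) * ln t) * expR (- t).
  by apply/funext => y; rewrite /gamma_integrand /powR gt_eqF.
apply: is_derive_eq.
rewrite /gamma_dintegrand /powR gt_eqF// /GRing.scale/=.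
by ring.
Qed.

Lemma continuous_gamma_dintegrand (t : R) : 0 < t ->
  continuous (gamma_dintegrand ^~ t).
Proof.
move=> t0 x.
have -> : gamma_dintegrand ^~ t =
    fun x => ln t * expR ((x - 1) * ln t) * expR (- t).
  by apply/funext => y; rewrite /gamma_dintegrand /powR gt_eqF.
by apply: differentiable_continuous; apply/derivable1_diffP; exact: ex_derive.
Qed.

Definition dGamma (x : R) := \int[mu]_(t in half_line) gamma_dintegrand x t.

Section GammaDerivative.
Variable q : R.
Hypotheses (q0 : 0 < q) (q1 : q < 1).

Let m0 : measurable half_line. Proof. exact: measurable_itv. Qed.
Let intD := integrable_gamma_dominator q0.

Let inhl (t : R) : half_line t -> 0 < t.
Proof. by rewrite /= in_itv/= andbT. Qed.

Let integrable_le_dominator (f : R -> R) : measurable_fun half_line f ->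
  (forall t, 0 < t -> `|f t| <= gamma_dominator q t) ->
  mu.-integrable half_line (EFin \o f).
Proof.
move=> mf fD; apply: le_integrable intD => //; first exact/measurable_EFinP.
move=> t /inhl t0 /=; rewrite lee_fin (le_trans (fD _ t0))//.
by rewrite ler_norm.
Qed.

Lemma integrable_gamma_integrand (x : R) : 2 * q < x < 2 ->
  mu.-integrable half_line (EFin \o gamma_integrand x).
Proof.
move=> /andP[qx x2]; apply: integrable_le_dominator.
  exact: measurable_gamma_integrand.
by move=> t t0; exact: gamma_integrand_le.
Qed.

Lemma integrable_gamma_dintegrand (x : R) : 2 * q < x < 2 ->
  mu.-integrable half_line (EFin \o gamma_dintegrand x).
Proof.
move=> /andP[qx x2]; apply: integrable_le_dominator.
  exact: measurable_gamma_dintegrand.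
by move=> t t0; exact: gamma_dintegrand_le.
Qed.

Lemma is_derive_Gamma (x : R) : 2 * q < x < 2 -> is_derive x 1 Gamma (dGamma x).
Proof.
move=> xq.
have Ix : `]2 * q, 2[%classic x by rewrite /= in_itv.
have partialE y t : 0 < t -> partial1of2 gamma_integrand y t = gamma_dintegrand y t.
  move=> t0; rewrite partial1of2E; have := is_derive_gamma_integrand y t0.
  by move=> [_ ->].
have intf y : `]2 * q, 2[%classic y ->
    mu.-integrable half_line (EFin \o gamma_integrand y).
  by rewrite /= in_itv; exact: integrable_gamma_integrand.
have derf y t : `]2 * q, 2[%classic y -> half_line t ->
    derivable (gamma_integrand ^~ t) y 1.
  by move=> _ /inhl t0; have [] := is_derive_gamma_integrand y t0.
have ub y t : `]2 * q, 2[%classic y -> half_line t ->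
    `|partial1of2 gamma_integrand y t| <= gamma_dominator q t.
  rewrite /= in_itv/= => /andP[qy y2] /inhl t0; rewrite partialE//.
  exact: gamma_dintegrand_le.
have D0 t : 0 <= gamma_dominator q t by exact: gamma_dominator_ge0.
have dG := @derivable_under_integral R _ _ mu gamma_integrand half_line m0 x (2 * q) 2
  Ix intf derf _ D0 intD ub.
have eG := @differentiation_under_integral R _ _ mu gamma_integrand half_line m0 x (2 * q) 2
  Ix intf derf _ D0 intD ub.
split; first exact: dG.
rewrite -derive1E; move: eG => ->.
by apply: eq_Rintegral => t; rewrite inE => /inhl t0; rewrite partialE.
Qed.

Lemma continuous_dGamma (x : R) : 2 * q < x < 2 -> {for x, continuous dGamma}.
Proof.
move=> xq.
have := @continuity_under_integral R _ _ mu gamma_dintegrand half_line m0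
  (2 * q) 2.
move=> /(_ _ _ (gamma_dominator q) intD); apply.
- by move=> y /=; rewrite in_itv; exact: integrable_gamma_dintegrand.
- by apply: aeW => t /inhl t0 y _; exact: continuous_gamma_dintegrand.
- move=> y /=; rewrite in_itv/= => /andP[qy y2].
  by apply: aeW => t /inhl t0; exact: gamma_dintegrand_le.
- by rewrite inE/= in_itv.
Qed.

Lemma dGamma_bounded : exists2 M : R, 0 <= M &
  forall x, 2 * q < x < 2 -> `|dGamma x| <= M.
Proof.
exists (\int[mu]_(t in half_line) gamma_dominator q t).
  by apply: Rintegral_ge0 => t _; exact: gamma_dominator_ge0.
move=> x xq; have ix := integrable_gamma_dintegrand xq.
apply: le_trans (@le_normr_Rintegral _ _ R mu half_line (gamma_dintegrand x) m0 ix) _.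
apply: le_Rintegral => //; first exact: integrable_norm.
by move=> t /inhl t0; move/andP : xq => [qx x2]; exact: gamma_dintegrand_le.
Qed.

End GammaDerivative.

(** For x <= 1 the integrand is at least exp(-1) on ]0, 1].  This keeps
    1 / Gamma bounded on the range of 1 - alpha. *)
Lemma Gamma_ge (x : R) : 0 < x <= 1 -> expR (- 1) <= Gamma x.
Proof.
move=> /andP[x0 x1].
(* any q with 2 q < x makes the integrand integrable *)
have q0 : 0 < x / 4 by rewrite divr_gt0.
have q1 : x / 4 < 1 by lra.
have ix : mu.-integrable half_line (EFin \o gamma_integrand x).
  by apply: (integrable_gamma_integrand q0 q1); apply/andP; split; lra.
have m01 : measurable (`]0%R, 1%R]%classic : set R) by exact: measurable_itv.
have m0 : measurable half_line by exact: measurable_itv.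
have sub : `]0%R, 1%R]%classic `<=` half_line by apply: subset_itvl.
have i1 := @integrableS _ _ R mu half_line `]0%R, 1%R]%classic _ m0 m01 sub ix.
apply: (@le_trans _ _ (\int[mu]_(t in `]0, 1]) gamma_integrand x t)).
  have mu1 : mu `]0%R, 1%R]%classic = 1%E.
    by rewrite lebesgue_measure_itv/= lte_fin ltr01 -EFinB subr0.
  have -> : expR (- 1) = \int[mu]_(t in `]0, 1]) (expR (- 1) : R).
    by rewrite Rintegral_cst// [X in fine X]mu1 mulr1.
  apply: le_Rintegral => //.
    apply: measurable_bounded_integrable => //; last exact: bounded_cst.
    by rewrite [X in (X < _)%E]mu1 ltry.
  move=> t /=; rewrite in_itv/= => /andP[t0 t1].
  rewrite /gamma_integrand -[leLHS]mul1r ler_pM// ?expR_ge0//.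
    have : t `^ 0 <= t `^ (x - 1) by apply: ger_powR; rewrite ?t0// subr_le0.
    by rewrite powRr0.
  by rewrite ler_expR lerN2.
rewrite /Gamma /Rintegral fine_le//.
- exact: integrable_fin_num.
- exact: integrable_fin_num.
apply: ge0_subset_integral => //.
  by apply/measurable_EFinP; exact: measurable_gamma_integrand.
by move=> t _; rewrite lee_fin mulr_ge0 ?powR_ge0 ?expR_ge0.
Qed.

Lemma Gamma1 : Gamma 1 = 1 :> R.
Proof.
rewrite /Gamma /Rintegral.
have -> : (\int[mu]_(t in half_line) (t `^ (1 - 1) * expR (- t))%:E =
           \int[mu]_(t in half_line) (expR (- t))%:E)%E.
  by apply: eq_integral => t _; rewrite subrr powRr0 mul1r.
have me : measurable_fun half_line (fun t : R => (expR (- t))%:E).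
  apply/measurable_EFinP; apply: measurable_funTS.
  by apply: (measurableT_comp (@measurable_expR R)); exact: measurable_funN.
rewrite integral_itv_obnd_cbnd//.
have dF (x : R) : is_derive x 1 (fun t => - expR (- t)) (expR (- x)).
  apply: is_derive_eq.
  by rewrite /GRing.scale/=; ring.
rewrite (@ge0_continuous_FTC2y _ (fun t : R => expR (- t))
  (fun t => - expR (- t)) 0 0)//.
- by rewrite oppr0 expR0 -EFinB opprK add0r.
- apply: continuous_in_subspaceT => x _.
  apply: differentiable_continuous; apply/derivable1_diffP.
  exact: ex_derive.
- have -> : (0 : R) = - 0 by rewrite oppr0.
  by apply: cvgN; exact: cvgr_expR.
- have c0 : {for 0, continuous (fun t : R => - expR (- t))}.
    apply: differentiable_continuous; apply/derivable1_diffP.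
    exact: (@ex_derive _ _ _ _ _ _ _ (dF 0)).
  exact: cvg_at_right_filter c0.
- by move=> x x0; rewrite derive1E derive_val.
Qed.

End GammaRegularity.

(** * The Abel kernel as a primitive *)

Section DerivOn.
Context {R : realType}.
Variables (T : R) (f g : R -> R).
Hypothesis fg : deriv_on T f g.

(** A derivative quotient constrains only the points s <> t of the segment. *)
Lemma near_within_dnbhsE (A : set R) (t : R) (P : R -> Prop) :
  (\forall s \near within A t^', P s) <->
  (\forall s \near t, s != t -> A s -> P s).
Proof. by rewrite near_withinE /dnbhs near_withinE. Qed.

Lemma deriv_on_continuous : {within `[0, T], continuous f}.
Proof.
apply/subspace_continuousP => t tT.
have c0 : f s - f t @[s --> within `[0, T]%classic t^'] --> (0 : R).
  have c1 : s - t @[s --> within `[0, T]%classic t^'] --> (0 : R).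
    rewrite -(subrr t); apply: cvgB; last exact: cvg_cst.
    apply: cvg_within_filter; apply: cvg_within_filter; exact: cvg_id.
  have c2 := fg tT.
  have c3 : (f s - f t) / (s - t) * (s - t) @[s --> within `[0, T]%classic t^'] --> g t * 0.
    exact: cvgM c2 c1.
  rewrite mulr0 in c3; apply: cvg_trans c3; apply: near_eq_cvg.
  apply/near_within_dnbhsE; near=> s => st _.
  by rewrite divfK// subr_eq0.
apply/cvgrPdist_lt => e e0.
move/cvgrPdist_lt : c0 => /(_ e e0)/near_within_dnbhsE; rewrite near_withinE.
apply: filterS => s H sT.
have [->|st] := eqVneq s t; first by rewrite subrr normr0.
by have := H st sT; rewrite sub0r opprB.
Unshelve. all: by end_near. Qed.

Lemma deriv_on_is_derive t : t \in `]0, T[ -> is_derive t 1 f (g t).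
Proof.
move=> tT.
have tT' : t \in `[0, T] by apply: subset_itv_oo_cc.
have cq : h^-1 *: (f (h *: 1 + t) - f t) @[h --> 0^'] --> g t.
  apply/cvgrPdist_lt => e e0.
  have /cvgrPdist_lt/(_ e e0)/near_within_dnbhsE H := fg tT'.
  have H1 : \forall s \near t, s \in `]0, T[ by exact: near_in_itvoo.
  have : \forall s \near t, s != t -> `|g t - (f s - f t) / (s - t)| < e.
    apply: filterS2 H H1 => s Hs sT st; apply: Hs => //=.
    exact: subset_itv_oo_cc.
  rewrite near_withinE (near_shift 0 t) => H2.
  apply: filterS H2 => s /= + s0.
  rewrite subr0 -[X in _ != X]add0r (inj_eq (addIr t)) => /(_ s0).
  by rewrite addrK /GRing.scale/= mulr1 mulrC.
split.
  by apply/cvg_ex; exists (g t); exact: cq.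
by apply/cvg_lim => //; exact: cq.
Qed.

End DerivOn.

Section AbelKernel.
Context {R : realType}.
Local Notation mu := (@lebesgue_measure R).
Variables (T : R) (alpha alpha' alpha'' : R -> R) (L : R).
Hypotheses (T0 : 0 < T) (L0 : 0 < L).
Hypotheses (dalpha : deriv_on T alpha alpha') (dalpha' : deriv_on T alpha' alpha'').
Hypothesis alpha'_le : forall t, t \in `[0, T] -> `|alpha' t| <= L.
Hypothesis alpha01 : forall t, t \in `]0, T] -> 0 < alpha t < 1.
Hypothesis alpha0 : alpha 0 = 0.

Lemma alpha_ge0_lt1 t : t \in `[0, T] -> 0 <= alpha t < 1.
Proof.
rewrite in_itv/= le_eqVlt => /andP[/predU1P[<- _|t0 tT]].
  by rewrite alpha0 lexx ltr01.
by have /andP[/ltW -> ->] : 0 < alpha t < 1 by apply: alpha01; rewrite in_itv/= t0.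
Qed.

(** The mean value theorem, with alpha(0) = 0.  This linear bound is what makes
    alpha(t) ln t bounded, and alpha(t) / t too. *)
Lemma alpha_le t : t \in `[0, T] -> alpha t <= L * t.
Proof.
rewrite in_itv/= le_eqVlt => /andP[/predU1P[<- _|t0 tT]].
  by rewrite alpha0 mulr0.
have sub : `[0, t] `<=` `[0, T] by apply: subset_itvl; rewrite bnd_simp.
have ct : {within `[0, t], continuous alpha}.
  exact: continuous_subspaceW sub (deriv_on_continuous dalpha).
have dt x : x \in `]0, t[ -> is_derive x 1 alpha (alpha' x).
  rewrite in_itv/= => /andP[x0 xt]; apply: (deriv_on_is_derive dalpha).
  by rewrite in_itv/= x0 (lt_le_trans xt).
have [c ct0] := MVT t0 dt ct.
rewrite alpha0 !subr0 => ->; apply: ler_wpM2r; first exact: ltW.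
apply: le_trans (ler_norm _) (alpha'_le _).
by apply: sub; exact: subset_itv_oo_cc.
Qed.

(** By compactness alpha stays away from 1, so 1 - alpha ranges in a strip
    where the Gamma integrands have a common majorant. *)
Lemma exists_gamma_strip : exists2 q : R, 0 < q < 1 &
  forall t, t \in `[0, T] -> 2 * q < 1 - alpha t < 2.
Proof.
have [c cT cmax] := EVT_max (ltW T0) (deriv_on_continuous dalpha).
have /andP[c0 c1] := alpha_ge0_lt1 cT.
exists ((1 - alpha c) / 4); first by apply/andP; split; lra.
move=> t tT; have := cmax t tT; have /andP[t0 t1] := alpha_ge0_lt1 tT.
by move=> tc; apply/andP; split; lra.
Qed.

(** The logarithmic derivative of the kernel, times the kernel. *)
Definition abel_kernel' (t : R) :=
  abel_kernel alpha t * (- alpha' t * ln t - alpha t / t +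
    alpha' t * (dGamma (1 - alpha t) / Gamma (1 - alpha t))).

Let inoc t : t \in `]0, T[ -> t \in `[0, T].
Proof. exact: subset_itv_oo_cc. Qed.

Lemma Gamma_alpha_gt0 t : t \in `[0, T] -> 0 < Gamma (1 - alpha t).
Proof.
move=> tT; have /andP[a0 a1] := alpha_ge0_lt1 tT.
apply: lt_le_trans (expR_gt0 (- 1)) _; apply: Gamma_ge.
by apply/andP; split; lra.
Qed.

Lemma is_derive_abel_kernel t : t \in `]0, T[ ->
  is_derive t 1 (abel_kernel alpha) (abel_kernel' t).
Proof.
move=> tT; have [q /andP[q0 q1] qa] := exists_gamma_strip.
have t0 : 0 < t by move: tT; rewrite in_itv/= => /andP[].
have tT' := inoc tT.
have da := deriv_on_is_derive dalpha tT.
have dG : is_derive t 1 (fun t => Gamma (1 - alpha t))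
    (- alpha' t * dGamma (1 - alpha t)).
  have d1 : is_derive t 1 (fun t => 1 - alpha t) (- alpha' t).
    by rewrite -[- alpha' t]sub0r; apply: is_deriveB.
  have d2 := is_derive_Gamma q0 q1 (qa _ tT').
  have := @is_derive1_comp _ Gamma (fun t => 1 - alpha t) t _ _ d2 d1.
  by rewrite mulrC.
have G0 := lt0r_neq0 (Gamma_alpha_gt0 tT').
have dGV := @is_deriveV _ (fun t => Gamma (1 - alpha t)) t _ 1 G0 dG.
have dln := is_derive1_ln t0.
have dk : is_derive t 1
    (fun t => expR (- alpha t * ln t) * (Gamma (1 - alpha t))^-1)
    (abel_kernel' t).
  have de : is_derive t 1 (fun t => expR (- alpha t * ln t))
      ((- alpha' t * ln t - alpha t / t) * expR (- alpha t * ln t)).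
    have dm : is_derive t 1 (fun t => - alpha t * ln t)
        (- alpha' t * ln t - alpha t / t).
      apply: is_derive_eq; rewrite /GRing.scale/=; ring.
    have := @is_derive1_comp _ expR (fun t => - alpha t * ln t) t _ _
      (is_derive_expR _) dm.
    by rewrite mulrC.
  apply: is_derive_eq.
  rewrite /abel_kernel' /abel_kernel /powR gt_eqF// /GRing.scale/=.
  rewrite expr2.
  by field; rewrite ?G0 (gt_eqF t0).
apply: (near_eq_is_derive _ dk).
near=> s; rewrite /abel_kernel /powR gt_eqF//.
by near: s; exact: lt_nbhsr.
Unshelve. all: by end_near. Qed.

Lemma continuous_abel_kernel' t : t \in `]0, T[ ->
  {for t, continuous abel_kernel'}.
Proof.
move=> tT; have [q /andP[q0 q1] qa] := exists_gamma_strip.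
have t0 : 0 < t by move: tT; rewrite in_itv/= => /andP[].
have tT' := inoc tT.
have cont_of_derive (f : R -> R) (df : R) : is_derive t 1 f df -> {for t, continuous f}.
  by move=> d; apply: differentiable_continuous; apply/derivable1_diffP;
    exact: (@ex_derive _ _ _ _ _ _ _ d).
have ck := cont_of_derive _ _ (is_derive_abel_kernel tT).
have ca := cont_of_derive _ _ (deriv_on_is_derive dalpha tT).
have ca' := cont_of_derive _ _ (deriv_on_is_derive dalpha' tT).
have cln := cont_of_derive _ _ (is_derive1_ln t0).
have c1a : {for t, continuous (fun t => 1 - alpha t)}.
  by apply: cvgB => //; exact: cvg_cst.
have cdG : {for t, continuous (fun t => dGamma (1 - alpha t))}.
  apply: (@continuous_comp _ _ _ (fun t => 1 - alpha t) dGamma t c1a).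
  exact: (continuous_dGamma q0 (qa _ tT')).
have cG : {for t, continuous (fun t => Gamma (1 - alpha t))}.
  apply: (@continuous_comp _ _ _ (fun t => 1 - alpha t) Gamma t c1a).
  apply: differentiable_continuous; apply/derivable1_diffP.
  exact: (@ex_derive _ _ _ _ _ _ _ (is_derive_Gamma q0 q1 (qa _ tT'))).
have G0 := lt0r_neq0 (Gamma_alpha_gt0 tT').
apply: cvgM => //; apply: cvgD; first apply: cvgB.
- by apply: cvgM => //; exact: cvgN.
- by apply: cvgM => //; apply: cvgV; rewrite ?gt_eqF//; exact: cvg_id.
- by apply: cvgM => //; apply: cvgM => //; exact: cvgV.
Qed.

Lemma mulN_ln_le (t : R) : 0 < t -> - (t * ln t) <= 1.
Proof.
move=> t0; rewrite -mulrN -ler_pdivlMl// mulr1 -lnV ?posrE//.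
have := @le_ln1Dx R (t^-1 - 1); rewrite [1 + _]addrC subrK => H.
have tV0 : 0 < t^-1 by rewrite invr_gt0.
by apply: le_trans (H _) _; lra.
Qed.

(** The power is at most exp(L), as - alpha(t) ln t <= L (- t ln t) <= L for
    t <= 1 and - alpha(t) ln t <= 0 for t > 1; and 1 / Gamma is at most e. *)
Lemma abel_kernel_le t : t \in `]0, T] ->
  `|abel_kernel alpha t| <= expR L * expR 1.
Proof.
rewrite in_itv/= => /andP[t0 tT].
have tT' : t \in `[0, T] by rewrite in_itv/= (ltW t0).
have /andP[a0 a1] := alpha_ge0_lt1 tT'.
rewrite /abel_kernel normrM; apply: ler_pM => //.
  rewrite ger0_norm ?powR_ge0// /powR gt_eqF// ler_expR.
  have [t1|t1] := leP t 1; last first.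
    rewrite mulNr (le_trans _ (ltW L0))// oppr_le0 mulr_ge0//.
    by rewrite ln_ge0// ltW.
  apply: (@le_trans _ _ (L * - (t * ln t))).
    have l0 : 0 <= - ln t by rewrite oppr_ge0 ln_le0.
    rewrite (_ : - alpha t * ln t = alpha t * - ln t); last by ring.
    rewrite (_ : L * - (t * ln t) = L * t * - ln t); last by ring.
    by rewrite ler_wpM2r// alpha_le.
  by rewrite ler_piMr ?(ltW L0)// mulN_ln_le.
have G0 := Gamma_alpha_gt0 tT'.
rewrite ger0_norm ?invr_ge0 ?(ltW G0)// -[leRHS]invrK -expRN lef_pV2 ?posrE ?expR_gt0//.
by apply: Gamma_ge; apply/andP; split; lra.
Qed.

(** The power t^(-1/2), with the exponent in the shape of
    [integrable_powR_oc01], is an integrable majorant of the logarithm near 0. *)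
Lemma norm_ln_le (t : R) : 0 < t ->
  `|ln t| <= 2 * (t `^ (2^-1 - 1) * \1_(`]0, 1]%classic) t) + t.
Proof.
move=> t0; rewrite indicE mem_setE in_itv/= t0/=.
have [t1|t1] := leP t 1.
  rewrite mulr1 ler0_norm ?ln_le0// -[leLHS]addr0 lerD ?(ltW t0)//.
  rewrite /powR gt_eqF//.
  have := expR_ge1Dx ((2^-1 - 1) * ln t).
  set e := expR _; set l := ln t; lra.
rewrite !mulr0 add0r ger0_norm ?ln_ge0 ?(ltW t1)//.
have := @le_ln1Dx R (t - 1); rewrite [1 + _]addrC subrK => H.
by apply: le_trans (H _) _; lra.
Qed.

(** The three terms of the logarithmic derivative are bounded by L |ln t|, by
    alpha(t) / t <= L and by a constant; only the first is singular. *)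
Lemma integrable_abel_kernel' : mu.-integrable `]0, T[ (EFin \o abel_kernel').
Proof.
have [q /andP[q0 q1] qa] := exists_gamma_strip.
have [M M0 leM] := dGamma_bounded q0.
have mT : measurable (`]0%R, T[%classic : set R) by exact: measurable_itv.
pose K := expR L * expR 1 : R.
have K0 : 0 <= K by rewrite mulr_ge0 ?expR_ge0.
pose D t := K * (2 * L) * (t `^ (2^-1 - 1) * \1_(`]0, 1]%classic) t) +
  K * (L * T + L + L * (M * expR 1)).
have intD : mu.-integrable `]0, T[ (EFin \o D).
  apply: (@integrableD _ _ _ mu `]0%R, T[%classic mT
    (fun t => (K * (2 * L) * (t `^ (2^-1 - 1) * \1_(`]0, 1]%classic) t))%:E)
    (fun t => (K * (L * T + L + L * (M * expR 1)))%:E)).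
    apply: (@integrableZl _ _ _ mu _ mT (K * (2 * L))
      (fun t => (t `^ (2^-1 - 1) * \1_(`]0, 1]%classic) t)%:E)).
    apply: (@integrableS _ _ _ mu setT) => //.
    have m1 : measurable (`]0%R, 1%R]%classic : set R) by exact: measurable_itv.
    have := (integrable_restrict mu m1 measurableT
      (EFin \o (fun t => t `^ (2^-1 - 1)))).1.
    have h0 : 0 < 2^-1 :> R by rewrite invr_gt0.
    rewrite setTI => /(_ (integrable_powR_oc01 h0)); apply: eq_integrable => // t _.
    by rewrite patchE /= indicE; case: ifP => _; rewrite ?mulr1 ?mulr0.
  apply: measurable_bounded_integrable => //; last exact: bounded_cst.
  by rewrite [X in (X < _)%E]lebesgue_measure_itv/= lte_fin T0 -EFinB ltry.
have mk : measurable_fun `]0, T[ abel_kernel'.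
  by apply: continuous_oo_measurable; exact: continuous_abel_kernel'.
apply: le_integrable intD => //; first exact/measurable_EFinP.
move=> t /= tT; rewrite lee_fin.
have tT' := inoc tT.
move: (tT); rewrite in_itv/= => /andP[t0 tltT].
rewrite (le_trans _ (ler_norm _))// /abel_kernel' normrM.
have kK : `|abel_kernel alpha t| <= K.
  by apply: abel_kernel_le; rewrite in_itv/= t0 ltW.
have G0 := Gamma_alpha_gt0 tT'.
have /andP[a0 a1] := alpha_ge0_lt1 tT'.
have GV : (Gamma (1 - alpha t))^-1 <= expR 1.
  rewrite -[leRHS]invrK -expRN lef_pV2 ?posrE ?expR_gt0//.
  by apply: Gamma_ge; apply/andP; split; lra.
rewrite (_ : D t = K * (L * (2 * (t `^ (2^-1 - 1) * \1_(`]0, 1]%classic) t) + T) + L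
  + L * (M * expR 1))); last by rewrite /D; ring.
apply: ler_pM => //.
apply: le_trans (ler_normD _ _) _; apply: lerD.
  apply: le_trans (ler_normB _ _) _; apply: lerD.
    rewrite normrM normrN; apply: ler_pM => //; first exact: alpha'_le.
    apply: le_trans (norm_ln_le t0) _; rewrite lerD2l; exact: ltW.
  by rewrite ger0_norm ?divr_ge0 ?(ltW t0)// ler_pdivrMr// alpha_le.
rewrite normrM; apply: ler_pM => //; first exact: alpha'_le.
rewrite normrM; apply: ler_pM => //; first by apply: leM; exact: qa.
by rewrite ger0_norm// invr_ge0 ltW.
Qed.

Lemma abel_kernel0 : abel_kernel alpha 0 = 1.
Proof. by rewrite /abel_kernel alpha0 oppr0 powRr0 addr0 Gamma1 divr1. Qed.

Lemma continuous_Gamma_alpha (F : set_system R) (FF : Filter F) t : t \in `[0, T] ->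
  alpha s @[s --> F] --> alpha t ->
  (Gamma (1 - alpha s))^-1 @[s --> F] --> (Gamma (1 - alpha t))^-1.
Proof.
move=> tT ca; have [q /andP[q0 q1] qa] := exists_gamma_strip.
apply: cvgV; first by rewrite gt_eqF// Gamma_alpha_gt0.
have c1 : 1 - alpha s @[s --> F] --> 1 - alpha t by apply: cvgB => //; exact: cvg_cst.
apply: (cvg_comp _ _ c1).
apply: differentiable_continuous; apply/derivable1_diffP.
exact: (@ex_derive _ _ _ _ _ _ _ (is_derive_Gamma q0 q1 (qa _ tT))).
Qed.

(** The delicate point is 0, where alpha(t) |ln t| <= L t |ln t| <= 2 L t^(1/2)
    tends to 0, so that the kernel tends to 1. *)
Lemma continuous_abel_kernel : {within `[0, T], continuous (abel_kernel alpha)}.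
Proof.
have /(continuous_within_itvP _ T0)[ca ca0 caT] := deriv_on_continuous dalpha.
have T0' : T \in `[0, T] by rewrite in_itv/= lexx ltW.
have z0' : 0 \in `[0, T] by rewrite in_itv/= lexx ltW.
apply/(continuous_within_itvP _ T0); split.
- move=> t tT; apply: differentiable_continuous; apply/derivable1_diffP.
  exact: (@ex_derive _ _ _ _ _ _ _ (is_derive_abel_kernel tT)).
- rewrite abel_kernel0 -[X in _ --> X](mulr1 1).
  apply: cvgM; last first.
    have := continuous_Gamma_alpha _ z0' ca0.
    by rewrite alpha0 subr0 Gamma1 invr1; apply.
  have c0 : - alpha t * ln t @[t --> 0^'+] --> (0 : R).
    apply/cvgr0Pnorm_le => e e0.
    have sq : t `^ (2^-1) @[t --> 0^'+] --> (0 : R).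
      by apply: powR_cvg0; rewrite invr_gt0.
    have /cvgr0Pnorm_le/(_ (e / (2 * L))) := sq.
    rewrite divr_gt0 ?mulr_gt0// => /(_ isT) sqe.
    near=> t.
    have t0 : 0 < t by near: t; exact: nbhs_right_gt.
    have t1 : t <= 1 by near: t; exact: nbhs_right_le.
    have tT : t \in `[0, T].
      by rewrite in_itv/= (ltW t0)/=; near: t; exact: nbhs_right_le.
    have /andP[a0 a1] := alpha_ge0_lt1 tT.
    have te : `|t `^ 2^-1| <= e / (2 * L) by near: t.
    rewrite normrM normrN (ger0_norm a0) (ler0_norm (ln_le0 t1)).
    have l0 : 0 <= - ln t by rewrite oppr_ge0 ln_le0.
    apply: (@le_trans _ _ (L * t * - ln t)); first by rewrite ler_wpM2r// alpha_le.
    have hl : - ln t <= 2 * t `^ (2^-1 - 1).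
      rewrite /powR gt_eqF//.
      have := expR_ge1Dx ((2^-1 - 1) * ln t).
      set x := expR _; set l := ln t; lra.
    have Lt0 : 0 <= L * t by rewrite mulr_ge0 ?ltW.
    apply: (le_trans (ler_wpM2l Lt0 hl)).
    rewrite (_ : L * t * _ = 2 * L * (t * t `^ (2^-1 - 1))); last by ring.
    rewrite mulr_powRB1 ?(ltW t0) ?invr_gt0// -ler_pdivlMl ?mulr_gt0//.
    by rewrite mulrC (le_trans (ler_norm _) te).
  have : expR (- alpha t * ln t) @[t --> 0^'+] --> expR 0.
    exact: (cvg_comp _ _ c0 (@continuous_expR R 0)).
  rewrite expR0; apply: cvg_trans; apply: near_eq_cvg.
  by near=> t; rewrite /powR gt_eqF.
- apply: cvgM; last exact: continuous_Gamma_alpha.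
  have c0 : - alpha t * ln t @[t --> T^'-] --> - alpha T * ln T.
    apply: cvgM; first exact: cvgN.
    by apply: cvg_at_left_filter; exact: continuous_ln.
  rewrite /powR gt_eqF//.
  have : expR (- alpha t * ln t) @[t --> T^'-] --> expR (- alpha T * ln T).
    exact: (cvg_comp _ _ c0 (@continuous_expR R _)).
  apply: cvg_trans; apply: near_eq_cvg.
  by near=> t; rewrite gt_eqF.
Unshelve. all: by end_near. Qed.

(** The second derivative of alpha makes alpha' continuous, hence also the
    derivative of the kernel, which is then the density. *)
Lemma abel_kernel_primitive : exists h : R -> R,
  [/\ mu.-integrable setT (EFin \o h), forall x, x <= 0 -> h x = 0 &
    forall t, t \in `[0, T] ->
      abel_kernel alpha t = 1 + \int[mu]_(s in `]0, t[) h s].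
Proof.
pose h := abel_kernel' \_ `]0, T[.
have mT : measurable (`]0%R, T[%classic : set R) by exact: measurable_itv.
exists h; split.
- rewrite /h -restrict_EFin; apply/integrable_restrict => //.
  by rewrite setTI; exact: integrable_abel_kernel'.
- by move=> x x0; rewrite /h patchE mem_setE in_itv/= ltNge x0.
move=> t tT; rewrite -abel_kernel0.
rewrite (improper_FTC T0 continuous_abel_kernel is_derive_abel_kernel
  continuous_abel_kernel' integrable_abel_kernel' tT).
congr (_ + _); apply: eq_Rintegral => s.
rewrite inE/= in_itv/= => /andP[s0 st]; rewrite /h patchE ifT// inE/= in_itv/= s0/=.
by move: tT; rewrite in_itv/= => /andP[_]; exact: lt_le_trans.
Qed.

End AbelKernel.

(** * Smooth functions *)

Section Smooth.
Context {R : realType}.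
Implicit Types (f g : R -> R) (n : nat).

(** The recursion runs on derive1 f, whereas derive1n differentiates on the
    outside; this way the closure properties go through by induction on n for
    all functions at once. *)
Fixpoint n_derivable n f : Prop :=
  if n is m.+1 then (forall x, derivable f x 1) /\ n_derivable m (derive1 f) else True.

Definition smooth f := forall n, n_derivable n f.

Lemma smooth_derivable1n f : smooth f -> forall n x, derivable (derive1n n f) x 1.
Proof.
move=> sf n; have {sf} := sf n.+1.
elim: n f => [|n IHn] f [df sf] x; first exact: df.
by rewrite /derive1n iterSr; exact: IHn.
Qed.

Lemma n_derivableW n f : n_derivable n.+1 f -> n_derivable n f.
Proof. by elim: n f => [//|n IHn] f [df sf]; split => //; exact: IHn. Qed.

Lemma n_derivableD n f g :
  n_derivable n f -> n_derivable n g -> n_derivable n (f \+ g).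
Proof.
elim: n f g => [//|n IHn] f g [df sf] [dg sg]; split.
  by move=> x; exact: derivableD.
have -> : derive1 (f \+ g) = derive1 f \+ derive1 g.
  by apply/funext => x; rewrite /= !derive1E deriveD.
exact: IHn.
Qed.

Lemma n_derivableM n f g :
  n_derivable n f -> n_derivable n g -> n_derivable n (f \* g).
Proof.
elim: n f g => [//|n IHn] f g /[dup] sf' [df sf] /[dup] sg' [dg sg]; split.
  by move=> x; exact: derivableM.
have -> : derive1 (f \* g) = (f \* derive1 g) \+ (g \* derive1 f).
  by apply/funext => x; rewrite /= !derive1E deriveM.
by apply: n_derivableD; apply: IHn => //; exact: n_derivableW.
Qed.

Lemma derive_affine f a b x : derivable f (a * x + b) 1 ->
  is_derive x 1 (fun x => f (a * x + b)) (a * derive1 f (a * x + b)).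
Proof.
move=> df.
have d1 : is_derive x 1 (fun x => a * x + b) a.
  by apply: is_derive_eq; rewrite /GRing.scale/= mulr1 addr0.
have d2 : is_derive (a * x + b) 1 f (derive1 f (a * x + b)).
  by split => //; rewrite derive1E.
have := @is_derive1_comp _ f (fun x => a * x + b) x _ _ d2 d1.
by rewrite mulrC.
Qed.

Lemma smooth_cst (c : R) : smooth (fun=> c).
Proof.
move=> n; elim: n c => [//|n IHn] c; split; first by move=> x; exact: derivable_cst.
rewrite (_ : derive1 _ = fun=> 0); first exact: IHn.
by apply/funext => x; rewrite derive1_cst.
Qed.

Lemma smoothD f g : smooth f -> smooth g -> smooth (f \+ g).
Proof. by move=> sf sg n; exact: n_derivableD. Qed.

Lemma smoothM f g : smooth f -> smooth g -> smooth (f \* g).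
Proof. by move=> sf sg n; exact: n_derivableM. Qed.

Lemma smooth_affine f a b : smooth f -> smooth (fun x => f (a * x + b)).
Proof.
move=> sf n; have {sf} := sf n.
elim: n f => [//|n IHn] f [df sf]; split.
  by move=> x; apply: (@ex_derive _ _ _ _ _ _ _ (derive_affine (df _))).
rewrite (_ : derive1 _ = (fun=> a) \* (fun x => derive1 f (a * x + b))).
  by apply: n_derivableM; [exact: smooth_cst|exact: IHn].
apply/funext => x; rewrite derive1E.
by have [_ ->] := derive_affine (df (a * x + b)).
Qed.

Lemma smooth_primitive f g : (forall x : R, is_derive x 1 f (g x)) -> smooth g -> smooth f.
Proof.
move=> fg sg [//|n]; split; first by move=> x; have [] := fg x.
rewrite (_ : derive1 f = g) ?sg//.
by apply/funext => x; rewrite derive1E; have [_ ->] := fg x.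
Qed.

End Smooth.

Section FlatFunction.
Context {R : realType}.
Implicit Types p : {poly R}.

Lemma cvg_id_expN (a : R) : 0 < a -> y * expR (- (a * y)) @[y --> +oo] --> (0 : R).
Proof.
move=> a0.
have h0 : 0 < a / 2 by rewrite divr_gt0.
have c1 : y * (a / 2) @[y --> +oo] --> +oo by exact: (gt0_cvgMly h0 cvg_id).
have c2 : (a / 2)^-1 * expR (- (y * (a / 2))) @[y --> +oo] --> (0 : R).
  rewrite -(mulr0 (a / 2)^-1); apply: cvgMr.
  exact: (@cvg_comp _ _ _ (fun r : R => r * (a / 2)) (fun y => expR (- y))
    _ _ _ c1 (@cvgr_expR R)).
apply: (@squeeze_cvgr _ _ _ _ (fun=> 0) _ _ _ _ _ c2); last exact: cvg_cst.
near=> y.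
have y0 : 0 < y by near: y; exact: nbhs_pinfty_gt.
rewrite mulr_ge0 ?(ltW y0) ?expR_ge0//=.
have -> : - (a * y) = - (y * (a / 2)) + - (y * (a / 2)) by field.
rewrite expRD mulrA ler_wpM2r ?expR_ge0//.
have := expR_ge1Dx (y * (a / 2)); rewrite expRN.
set e := expR _; have e0 : 0 < e by exact: expR_gt0.
rewrite ler_pdivrMr// ler_pdivlMl// mulrC; lra.
Unshelve. all: by end_near. Qed.

Lemma cvg_poly_expN p (a : R) : 0 < a ->
  p.[y] * expR (- (a * y)) @[y --> +oo] --> (0 : R).
Proof.
elim/poly_ind: p a => [|p c IHp] a a0.
  rewrite (_ : (fun y => _) = cst 0); first exact: cvg_cst.
  by apply/funext => y; rewrite horner0 mul0r.
have h0 : 0 < a / 2 by rewrite divr_gt0.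
have E y : (p * 'X + c%:P).[y] * expR (- (a * y)) =
    (p.[y] * expR (- (a / 2 * y))) * (y * expR (- (a / 2 * y))) + c * expR (- (y * a)).
  rewrite hornerMXaddC mulrDl [in RHS](mulrC y a); congr (_ + _).
  have -> : - (a * y) = - (a / 2 * y) + - (a / 2 * y) by field.
  by rewrite expRD; ring.
rewrite (funext E).
have Z : (0 : R) = 0 * 0 + c * 0 by rewrite !mulr0 addr0.
rewrite [X in _ --> X]Z.
apply: cvgD.
  by apply: cvgM; [exact: IHp|exact: cvg_id_expN].
apply: cvgMr.
have c1 : y * a @[y --> +oo] --> +oo by exact: (gt0_cvgMly a0 cvg_id).
exact: (@cvg_comp _ _ _ (fun r : R => r * a) (fun y => expR (- y))
    _ _ _ c1 (@cvgr_expR R)).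
Qed.

(** Multiples p(1/x) exp(-1/x) of the standard flat function.  Carrying the
    polynomial p makes the class stable under differentiation, and smoothness
    becomes a one-line induction. *)
Definition flat p (x : R) := if 0 < x then p.[x^-1] * expR (- x^-1) else 0.

Definition flat_derivative p := 'X^2 * (p - p^`()).

(** At 0 the difference quotient for h > 0 is (y p(y)) exp(-y) with y = 1/h, and
    exponentials beat polynomials. *)
Lemma is_derive_flat p (x : R) : is_derive x 1 (flat p) (flat (flat_derivative p) x).
Proof.
have [x0|x0|->] := ltgtP x 0.
- rewrite {2}/flat ltNge (ltW x0)/=.
  apply: (near_eq_is_derive _ (is_derive_cst 0 x 1)).
  near=> y; rewrite /flat ltNge (_ : y <= 0)//; apply: ltW.
  by near: y; exact: lt_nbhsl.
- have dV : is_derive x 1 (fun x : R => x^-1) (- (x ^- 2)).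
    have := @is_deriveV _ id x 1 1 (lt0r_neq0 x0) (is_derive_id x 1).
    by rewrite /GRing.scale/= mulr1.
  have dp : is_derive x 1 (fun x => p.[x^-1]) (- (x ^- 2) * p^`().[x^-1]).
    have d1 : is_derive x^-1 1 (horner p) (p^`().[x^-1]).
      split; first exact: derivable_horner.
      by rewrite -derive1E -derivE.
    have := @is_derive1_comp _ (horner p) (fun x : R => x^-1) x _ _ d1 dV.
    by rewrite mulrC.
  have de : is_derive x 1 (fun x => expR (- x^-1)) (x ^- 2 * expR (- x^-1)).
    have d1 : is_derive x 1 (fun x : R => - x^-1) (x ^- 2).
      by rewrite -[x ^- 2]opprK; exact: is_deriveN.
    have := @is_derive1_comp _ expR (fun x : R => - x^-1) x _ _ (is_derive_expR _) d1.
    by rewrite mulrC.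
  have dd : is_derive x 1 (fun x => p.[x^-1] * expR (- x^-1))
      (flat (flat_derivative p) x).
    apply: is_derive_eq; rewrite /flat x0 /flat_derivative !hornerE/=.
    by rewrite /GRing.scale/= exprVn; ring.
  apply: (near_eq_is_derive _ dd).
  near=> y; rewrite /flat (_ : 0 < y)//.
  by near: y; exact: lt_nbhsr.
- rewrite {2}/flat ltxx.
  have cq : h^-1 *: (flat p (h *: 1 + 0) - flat p 0) @[h --> 0^'] --> (0 : R).
    have cr : ('X * p).[y] * expR (- (1 * y)) @[y --> +oo] --> (0 : R).
      by apply: cvg_poly_expN.
    apply/cvgr0Pnorm_le => e e0.
    have /cvgr0Pnorm_le/(_ e e0)[M [_ HM]] := cr.
    near=> h.
    have h0 : h != 0 by near: h; exact: nbhs_dnbhs_neq.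
    have hM : `|h| < (`|M| + 1)^-1.
      by near: h; apply: dnbhs0_lt; rewrite invr_gt0 ltr_wpDl.
    rewrite /GRing.scale/= mulr1 addr0 {2}/flat ltxx subr0 /flat.
    case: ifPn => [hpos|_]; last by rewrite mulr0 normr0 ltW.
    have /HM : M < h^-1.
      have MV : `|M| + 1 < h^-1.
        rewrite -[ltLHS]invrK ltf_pV2 ?posrE ?invr_gt0 ?ltr_wpDl//.
        by rewrite (le_lt_trans (ler_norm h)).
      by apply: le_lt_trans (ler_norm M) _; apply: lt_trans MV; rewrite ltrDl.
    by rewrite hornerM hornerX mul1r mulrA.
  split; first by apply/cvg_ex; exists 0; exact: cq.
  by apply/cvg_lim => //; exact: cq.
Unshelve. all: by end_near. Qed.

Lemma smooth_flat p : smooth (flat p).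
Proof.
move=> n; elim: n p => [//|n IHn] p; split.
  by move=> x; exact: (@ex_derive _ _ _ _ _ _ _ (is_derive_flat p x)).
rewrite (_ : derive1 _ = flat (flat_derivative p)) ?IHn//.
by apply/funext => x; rewrite derive1E; have [_ ->] := is_derive_flat p x.
Qed.

End FlatFunction.

(** * Smooth steps and mollifiers *)

Section SmoothStep.
Context {R : realType}.
Local Notation mu := (@lebesgue_measure R).
Local Notation bell := (flat (1 : {poly R})).

Lemma bell_gt0 (x : R) : 0 < x -> 0 < bell x.
Proof. by move=> x0; rewrite /flat x0 hornerC mul1r expR_gt0. Qed.

Lemma bell_eq0 (x : R) : x <= 0 -> bell x = 0.
Proof. by move=> x0; rewrite /flat ltNge x0. Qed.

Lemma bell_ge0 (x : R) : 0 <= bell x.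
Proof. by have [/bell_eq0->//|/bell_gt0/ltW] := leP x 0. Qed.

Definition bump (x : R) := bell x * bell (-1 * x + 1).

Lemma smooth_bump : smooth bump.
Proof.
by apply: (@smoothM _ bell (fun x => bell (-1 * x + 1)));
  [exact: smooth_flat|apply: smooth_affine; exact: smooth_flat].
Qed.

Lemma bump_ge0 x : 0 <= bump x.
Proof. by rewrite mulr_ge0 ?bell_ge0. Qed.

Lemma bump_gt0 x : 0 < x < 1 -> 0 < bump x.
Proof. by move=> /andP[x0 x1]; rewrite mulr_gt0 ?bell_gt0//; lra. Qed.

Lemma bump_le0 x : x <= 0 -> bump x = 0.
Proof. by move=> x0; rewrite /bump bell_eq0// mul0r. Qed.

Lemma bump_ge1 x : 1 <= x -> bump x = 0.
Proof. by move=> x1; rewrite /bump [X in _ * X]bell_eq0 ?mulr0//; lra. Qed.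

Lemma continuous_bump : continuous bump.
Proof.
move=> x; apply: differentiable_continuous; apply/derivable1_diffP.
by have [+ _] := smooth_bump 1; exact.
Qed.

Lemma integrable_continuous_itv (f : R -> R) (a b : R) : continuous f ->
  mu.-integrable `[a, b] (EFin \o f).
Proof.
move=> cf; apply: continuous_compact_integrable; first exact: segment_compact.
exact: continuous_subspaceT.
Qed.

(** The lower bound -1 has no effect on the value, since the bump vanishes on
    ]-oo, 0]; it makes 0 an interior point for the fundamental theorem. *)
Definition smooth_step (x : R) := \int[mu]_(t in `[-1, x]) bump t.

Lemma smooth_step_le0 x : x <= 0 -> smooth_step x = 0.
Proof.
move=> x0; rewrite /smooth_step (@eq_Rintegral _ _ _ mu _ (cst 0)).
  by rewrite Rintegral_cst// mul0r.
move=> t; rewrite inE/= in_itv/= => /andP[_ tx].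
by rewrite bump_le0// (le_trans tx).
Qed.

Lemma is_derive_smooth_step (x : R) : is_derive x 1 smooth_step (bump x).
Proof.
have [x0|x0] := ltP x 0.
  rewrite bump_le0 ?(ltW x0)//.
  apply: (near_eq_is_derive _ (is_derive_cst 0 x 1)).
  near=> y; rewrite smooth_step_le0//; apply: ltW.
  by near: y; exact: lt_nbhsl.
have x1 : x < x + 1 by rewrite ltrDl.
have xN1 : -1 < x by apply: lt_le_trans x0; rewrite ltrN10.
have [d1 d2] := continuous_FTC1_closed x1
  (integrable_continuous_itv (-1) (x + 1) continuous_bump) xN1 (@continuous_bump x).
by apply: DeriveDef; [exact: d1|rewrite -derive1E; exact: d2].
Unshelve. all: by end_near. Qed.

Lemma smooth_smooth_step : smooth smooth_step.
Proof. exact: smooth_primitive is_derive_smooth_step smooth_bump. Qed.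

Lemma continuous_smooth_step : continuous smooth_step.
Proof.
move=> x; apply: differentiable_continuous; apply/derivable1_diffP.
exact: (@ex_derive _ _ _ _ _ _ _ (is_derive_smooth_step x)).
Qed.

Lemma smooth_step_MVT (x y : R) : x < y ->
  exists2 c, c \in `]x, y[ & smooth_step y - smooth_step x = bump c * (y - x).
Proof.
move=> xy; apply: MVT => // [c _|]; first exact: is_derive_smooth_step.
exact: continuous_subspaceT continuous_smooth_step.
Qed.

Lemma smooth_step_nd (x y : R) : x <= y -> smooth_step x <= smooth_step y.
Proof.
rewrite le_eqVlt => /predU1P[->//|xy].
have [c _ E] := smooth_step_MVT xy.
by rewrite -subr_ge0 E mulr_ge0 ?bump_ge0// subr_ge0 ltW.
Qed.

Lemma smooth_step1_gt0 : 0 < smooth_step 1.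
Proof.
have [c] := smooth_step_MVT (@ltr01 R).
rewrite in_itv/= (smooth_step_le0 (lexx 0)) !subr0 mulr1 => c01 ->.
exact: bump_gt0.
Qed.

Lemma smooth_step_ge1 x : 1 <= x -> smooth_step x = smooth_step 1.
Proof.
rewrite le_eqVlt => /predU1P[<-//|x1].
have [c] := smooth_step_MVT x1.
rewrite in_itv/= => /andP[c1 _]; rewrite bump_ge1 ?(ltW c1)// mul0r.
by move/eqP; rewrite subr_eq0 => /eqP.
Qed.

Lemma smooth_step_bounds x : 0 <= smooth_step x <= smooth_step 1.
Proof.
apply/andP; split.
  have [x0|x0] := leP x 0; first by rewrite smooth_step_le0.
  by rewrite -(smooth_step_le0 (lexx 0)) smooth_step_nd// ltW.
have [x1|x1] := leP x 1; first exact: smooth_step_nd.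
by rewrite smooth_step_ge1// ltW.
Qed.

End SmoothStep.

Section Mollifier.
Context {R : realType}.
Local Notation mu := (@lebesgue_measure R).
Variables (T e a : R).
Hypotheses (e0 : 0 < e) (a0 : 0 <= a) (aT : (a + 1) * e <= T).

(** The bump rescaled to the interval [a e, (a + 1) e], of mass smooth_step 1
    and not 1. *)
Definition mollifier (t : R) := e^-1 * bump (e^-1 * t + (- a)).

Let T0 : 0 < T.
Proof. by rewrite (lt_le_trans _ aT)// mulr_gt0// ltr_wpDl. Qed.

Lemma is_derive_step_mollifier (t : R) :
  is_derive t 1 (fun t => smooth_step (e^-1 * t + (- a))) (mollifier t).
Proof.
have d := is_derive_smooth_step (e^-1 * t - a).
have := derive_affine (@ex_derive _ _ _ _ _ _ _ d).
by rewrite derive1E (@derive_val _ _ _ _ _ _ _ d).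
Qed.

Lemma mollifier_ge0 t : 0 <= mollifier t.
Proof. by rewrite mulr_ge0 ?bump_ge0// invr_ge0 ltW. Qed.

Lemma continuous_mollifier : continuous mollifier.
Proof.
move=> t; apply: cvgM; first exact: cvg_cst.
apply: (@continuous_comp _ _ _ (fun t => e^-1 * t + - a) bump).
  by apply: cvgD; [apply: cvgM; [exact: cvg_cst|exact: cvg_id]|exact: cvg_cst].
exact: continuous_bump.
Qed.

Lemma mollifier_supp t : t \notin `[a * e, (a + 1) * e] -> mollifier t = 0.
Proof.
rewrite in_itv/= negb_and -!ltNge => /orP[ta|ta]; rewrite /mollifier.
  rewrite bump_le0 ?mulr0// subr_le0 ler_pdivrMl//; rewrite mulrC; exact: ltW.
rewrite bump_ge1 ?mulr0// lerBrDl ler_pdivlMl// mulrC; exact: ltW.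
Qed.

Lemma integrable_mollifier : mu.-integrable `]0, T[ (EFin \o mollifier).
Proof.
apply: (@integrableS _ _ _ mu `[0, T]) => //.
  by apply: subset_itvW; rewrite bnd_simp.
exact: integrable_continuous_itv continuous_mollifier.
Qed.

Lemma integral_mollifier : \int[mu]_(t in `]0, T[) mollifier t = smooth_step 1.
Proof.
have cF : {within `[0, T], continuous (fun t => smooth_step (e^-1 * t + (- a)))}.
  apply: continuous_subspaceT => t; apply: differentiable_continuous.
  apply/derivable1_diffP.
  exact: (@ex_derive _ _ _ _ _ _ _ (is_derive_step_mollifier t)).
have TT : T \in `[0, T] by rewrite in_itv/= lexx ltW.
have := @improper_FTC _ T _ mollifier T0 cF
  (fun x _ => is_derive_step_mollifier x) (fun x _ => @continuous_mollifier x)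
  integrable_mollifier T TT.
rewrite mulr0 add0r [X in _ = X + _]smooth_step_le0 ?oppr_le0// add0r => <-.
by rewrite smooth_step_ge1// lerBrDl ler_pdivlMl// mulrC.
Qed.

(** An average of values within eta of y is within eta of y. *)
Lemma mollifier_approx (f : R -> R) (y eta : R) :
  mu.-integrable `]0, T[ (EFin \o (fun t => f t * mollifier t)) ->
  (forall t, t \in `[a * e, (a + 1) * e] -> `|f t - y| <= eta) ->
  `|\int[mu]_(t in `]0, T[) (f t * mollifier t) - smooth_step 1 * y| <=
    eta * smooth_step 1.
Proof.
move=> ifm fy.
have mT : measurable (`]0%R, T[%classic : set R) by exact: measurable_itv.
have im := integrable_mollifier.
have iym : mu.-integrable `]0, T[ (EFin \o (fun t => y * mollifier t)).
  exact: (@integrableZl _ _ _ mu _ mT y (EFin \o mollifier)).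
have iem : mu.-integrable `]0, T[ (EFin \o (fun t => eta * mollifier t)).
  exact: (@integrableZl _ _ _ mu _ mT eta (EFin \o mollifier)).
have E1 : smooth_step 1 * y = \int[mu]_(t in `]0, T[) (y * mollifier t).
  by rewrite mulrC -integral_mollifier -(@RintegralZl _ _ R mu _ mollifier y mT im).
have E2 : eta * smooth_step 1 = \int[mu]_(t in `]0, T[) (eta * mollifier t).
  by rewrite -integral_mollifier -(@RintegralZl _ _ R mu _ mollifier eta mT im).
rewrite E1 E2 -(@RintegralB _ _ R mu _ _ _ mT ifm iym).
have ib : mu.-integrable `]0, T[
    (EFin \o (fun t => f t * mollifier t - y * mollifier t)).
  exact: (@integrableB _ _ R mu _ mT _ _ ifm iym).
apply: le_trans (@le_normr_Rintegral _ _ R mu _ _ mT ib) _.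
apply: (@le_Rintegral _ _ R mu) => //.
  exact: (@integrable_norm _ _ R mu _ (fun t => f t * mollifier t - y * mollifier t)).
move=> t _; rewrite -mulrBl normrM (ger0_norm (mollifier_ge0 t)).
have [ts|/mollifier_supp->] := boolP (t \in `[a * e, (a + 1) * e]).
  by rewrite ler_wpM2r ?mollifier_ge0// fy.
by rewrite !mulr0.
Qed.

End Mollifier.

(** * Functions of W11 are primitives of their weak derivative *)

Section WeakDerivative.
Context {R : realType}.
Local Notation mu := (@lebesgue_measure R).
Variables (T : R) (f f' : R -> R) (b : R).
Hypotheses (T0 : 0 < T) (fW : in_W11 T f f') (b0 : 0 < b) (bT : b <= T).
Local Notation D := (`]0%R, T[%classic : set R).

(** A scale at which b is an integral number n + 4 of steps.  The cutoff below
    climbs on the second step and falls on the last but one. *)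
Let mesh n : R := b / n.+4%:R.

Let mesh_gt0 n : 0 < mesh n.
Proof. by rewrite divr_gt0. Qed.

Let meshE n (x : R) : (mesh n)^-1 * x = n.+4%:R * (x / b).
Proof. by rewrite /mesh invfM invrK; ring. Qed.

Let mesh_mul n (m : R) : m <= n.+3%:R -> (m + 1) * mesh n <= b.
Proof.
move=> mn; rewrite /mesh mulrA ler_pdivrMr// mulrC ler_pM2l//.
by rewrite -natr1 lerD2r.
Qed.

Lemma integrable_continuous_mollifier (e a : R) :
  mu.-integrable D (EFin \o (fun t => f t * mollifier e a t)).
Proof.
have [cf _ _ _] := fW.
apply: (@integrableS _ _ _ mu `[0, T]) => //.
  by apply: subset_itvW; rewrite bnd_simp.
apply: continuous_compact_integrable; first exact: segment_compact.
move=> x; apply: cvgM; first exact: cf.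
apply: continuous_subspaceT; exact: continuous_mollifier.
Qed.

(** The mollifiers concentrate at y, where f is continuous. *)
Lemma cvg_integral_mollifier (y : R) (a : nat -> R) : y \in `[0, T] ->
  (forall n, 0 <= a n <= n.+3%:R) ->
  (forall n t, t \in `[a n * mesh n, (a n + 1) * mesh n] -> `|y - t| <= 2 * mesh n) ->
  \int[mu]_(t in D) (f t * mollifier (mesh n) (a n) t) @[n --> \oo] -->
    smooth_step 1 * f y.
Proof.
move=> yT a0 ay; have [cf _ _ _] := fW.
have S0 := @smooth_step1_gt0 R.
apply/cvgrPdist_le => eta eta0.
have /subspace_continuousP/(_ y) := cf => /(_ yT)/cvgrPdist_le.
move/(_ (eta / smooth_step 1) (divr_gt0 eta0 S0)).
rewrite near_withinE => -[d /= d0 fd].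
have dn0 : 0 < d / (2 * b) by rewrite divr_gt0// mulr_gt0.
near=> n.
have nd : 2 * mesh n < d.
  have : n.+1%:R^-1 < d / (2 * b) by near: n; exact: (near_infty_natSinv_lt (PosNum dn0)).
  rewrite ltr_pdivlMr ?mulr_gt0// => /(le_lt_trans _); apply.
  rewrite /mesh mulrA mulrC ler_wpM2r ?mulr_ge0 ?(ltW b0)//.
  by rewrite lef_pV2 ?posrE// ler_nat ltnS -addn3 leq_addr.
have [an0 an] := andP (a0 n).
have anT : (a n + 1) * mesh n <= T by rewrite (le_trans (mesh_mul an)).
have fI t : t \in `[a n * mesh n, (a n + 1) * mesh n] ->
    `|f t - f y| <= eta / smooth_step 1.
  move=> tI; rewrite distrC; apply: fd; first by rewrite /= (le_lt_trans (ay _ _ tI)).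
  move: tI; rewrite /= !in_itv/= => /andP[t1 t2]; apply/andP; split.
    by rewrite (le_trans _ t1)// mulr_ge0// ltW.
  exact: le_trans anT.
have := mollifier_approx (mesh_gt0 n) an0 anT
  (integrable_continuous_mollifier (mesh n) (a n)) fI.
by rewrite divfK ?gt_eqF// distrC.
Unshelve. all: by end_near. Qed.

(** A smooth approximation, from inside, of smooth_step 1 times the indicator
    function of ]0, b[. *)
Definition cutoff n (t : R) :=
  smooth_step ((mesh n)^-1 * t + (- 1)) - smooth_step ((mesh n)^-1 * t + (- n.+2%:R)).

Lemma derive_cutoff n t :
  derive1 (cutoff n) t = mollifier (mesh n) 1 t - mollifier (mesh n) n.+2%:R t.
Proof.
have := is_deriveB (is_derive_step_mollifier (mesh n) 1 t)
  (is_derive_step_mollifier (mesh n) n.+2%:R t).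
by rewrite derive1E => -[_ <-].
Qed.

Lemma smooth_cutoff n : smooth (cutoff n).
Proof.
rewrite (_ : cutoff n = (fun t => smooth_step ((mesh n)^-1 * t + (- 1))) \+
   ((fun=> -1) \* (fun t => smooth_step ((mesh n)^-1 * t + (- n.+2%:R))))).
  apply: smoothD; first exact/smooth_affine/smooth_smooth_step.
  by apply: smoothM; [exact: smooth_cst|exact/smooth_affine/smooth_smooth_step].
by apply/funext => t; rewrite /cutoff/= mulN1r.
Qed.

Lemma cutoff_eq0 n t : t \notin `[mesh n, b - mesh n] -> cutoff n t = 0.
Proof.
rewrite in_itv/= negb_and -!ltNge /cutoff !meshE => /orP[tm|tm].
  have t1 : n.+4%:R * (t / b) <= 1.
    by rewrite mulrA ler_pdivrMr// mul1r mulrC -ler_pdivlMr// ltW.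
  have n2 : (1 : R) <= n.+2%:R by rewrite ler1n.
  by rewrite !smooth_step_le0 ?subrr//; lra.
have t1 : n.+3%:R <= n.+4%:R * (t / b).
  have m0 : 0 < n.+4%:R :> R by [].
  have -> : (n.+3%:R : R) = n.+4%:R - 1 by rewrite -[n.+4%:R]natr1 addrK.
  rewrite mulrA ler_pdivlMr//.
  have -> : (n.+4%:R - 1) * b = n.+4%:R * (b - mesh n).
    by rewrite mulrBr mulrBl mul1r [n.+4%:R * mesh n]mulrC divfK.
  by rewrite ler_pM2l// ltW.
have n2 : (n.+3%:R : R) = n.+2%:R + 1 by rewrite natr1.
have n3 : (1 : R) <= n.+2%:R by rewrite ler1n.
move: t1 n2 n3; move: (_ * _) (n.+3%:R) (n.+2%:R) => x m3 m2 t1 n2 n3.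
rewrite (@smooth_step_ge1 _ (x - 1)); last by lra.
by rewrite (@smooth_step_ge1 _ (x - m2)) ?subrr//; lra.
Qed.

Lemma test_function_cutoff n : test_function T (cutoff n).
Proof.
have sub : closure [set x | cutoff n x != 0] `<=` `[mesh n, b - mesh n]%classic.
  have /closure_id -> : closed (`[mesh n, b - mesh n]%classic : set R).
    exact: interval_closed.
  by apply: closure_subset => x /=; apply: contra_neqT; exact: cutoff_eq0.
split; first exact/smooth_derivable1n/smooth_cutoff.
  apply: (subclosed_compact _ (@segment_compact _ (mesh n) (b - mesh n)) sub).
  exact: closed_closure.
apply: (subset_trans sub); apply: subset_itv; rewrite bnd_simp//.
by rewrite (lt_le_trans _ bT)// ltrBlDr ltrDl.
Qed.

Lemma cutoff_bounded n t : `|cutoff n t| <= smooth_step 1.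
Proof.
rewrite /cutoff; move: (smooth_step_bounds ((mesh n)^-1 * t + (- 1)))
  (smooth_step_bounds ((mesh n)^-1 * t + (- n.+2%:R))).
set x := smooth_step _; set y := smooth_step (_ - _); set z := smooth_step 1.
by move=> /andP[x0 x1] /andP[y0 y1]; rewrite ler_norml; apply/andP; split; lra.
Qed.

Lemma cvg_cutoff t : 0 < t ->
  cutoff n t @[n --> \oo] --> (if t < b then smooth_step 1 else 0).
Proof.
move=> t0; case: ltP => [tb|bt]; last first.
  rewrite (_ : (fun n => cutoff n t) = fun=> 0); first exact: cvg_cst.
  apply/funext => n; apply: cutoff_eq0; rewrite in_itv/= negb_and -!ltNge.
  by rewrite (lt_le_trans _ bt) ?orbT// ltrBlDr ltrDl.
have [s sE] : exists s : R, s = t / b by exists (t / b).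
have s0 : 0 < s by rewrite sE divr_gt0.
have s1 : s < 1 by rewrite sE ltr_pdivrMr// mul1r.
have r0 : 0 < s / 2 by rewrite divr_gt0.
have r1 : 0 < (1 - s) / 2 by rewrite divr_gt0// subr_gt0.
apply: cvg_near_cst; near=> n; apply/eqP.
have n0 : (0 : R) < n.+1%:R by [].
have e1 : n.+1%:R^-1 < s / 2 by near: n; exact: (near_infty_natSinv_lt (PosNum r0)).
have e2 : n.+1%:R^-1 < (1 - s) / 2.
  by near: n; exact: (near_infty_natSinv_lt (PosNum r1)).
have {}e1 : 2 < s * n.+1%:R.
  by move: e1; rewrite invf_plt ?posrE// invf_div ltr_pdivrMr// mulrC.
have {}e2 : 2 < (1 - s) * n.+1%:R.
  by move: e2; rewrite invf_plt ?posrE// invf_div ltr_pdivrMr ?subr_gt0// mulrC.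
have E4 : (n.+4%:R : R) = n.+1%:R + 3 by rewrite -natrD addn3.
have E2 : (n.+2%:R : R) = n.+1%:R + 1 by rewrite natr1.
rewrite /cutoff !meshE -sE E4 E2; move: (n.+1%:R : R) n0 e1 e2 => m m0 e1 e2.
rewrite smooth_step_ge1; last by nra.
by rewrite (@smooth_step_le0 _ (_ - _)) ?subr0//; nra.
Unshelve. all: by end_near. Qed.

(** Test the weak derivative against the cutoffs.  Their derivatives are
    mollifiers concentrating at 0 and, negatively, at b, so one side tends to
    smooth_step 1 (f 0 - f b); the other tends to minus smooth_step 1 times the
    integral of f' over ]0, b[ by dominated convergence. *)
Lemma W11_primitive_gt0 : f b - f 0 = \int[mu]_(t in `]0, b[) f' t.
Proof.
have [cf fL f'L wd] := fW.
have mD : measurable D by exact: measurable_itv.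
have mb : measurable (`]0%R, b[%classic : set R) by exact: measurable_itv.
have S0 := @smooth_step1_gt0 R.
have bT0 : b \in `[0, T] by rewrite in_itv/= (ltW b0).
have c0 := @cvg_integral_mollifier 0 (fun=> 1).
have cb := @cvg_integral_mollifier b (fun n => n.+2%:R) bT0.
have lhs : \int[mu]_(t in D) (f t * derive1 (cutoff n) t) @[n --> \oo] -->
    smooth_step 1 * f 0 - smooth_step 1 * f b.
  rewrite (_ : (fun n => _) = (fun n =>
     \int[mu]_(t in D) (f t * mollifier (mesh n) 1 t) -
     \int[mu]_(t in D) (f t * mollifier (mesh n) n.+2%:R t))).
    apply: cvgB.
      apply: c0; first by rewrite in_itv/= lexx ltW.
        by move=> n; rewrite ler01 ler1n.
      move=> n t; rewrite in_itv/= mul1r => /andP[t1 t2].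
      by rewrite sub0r normrN ger0_norm// (le_trans _ t1)// ltW.
    apply: cb; first by move=> n; rewrite ler0n ler_nat/=.
    move=> n t; rewrite in_itv/= => /andP[t1 t2].
    have bE : b = n.+2%:R * mesh n + 2 * mesh n.
      by rewrite -mulrDl -natrD addn2 /mesh mulrC divfK.
    have := mesh_gt0 n; move: bE t1 t2; set e := mesh n; set m := n.+2%:R.
    move=> bE t1 t2 e0.
    by rewrite ler_norml; apply/andP; split; lra.
  apply/funext => n; rewrite -(@RintegralB _ _ R mu _ _ _ mD);
    try exact: integrable_continuous_mollifier.
  by apply: eq_Rintegral => t _; rewrite derive_cutoff mulrBr.
have rhs : \int[mu]_(t in D) (f' t * cutoff n t) @[n --> \oo] -->
    smooth_step 1 * \int[mu]_(t in `]0, b[) f' t.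
  pose G t := if t < b then smooth_step 1 * f' t else 0.
  have mf' : measurable_fun D f' by apply/measurable_EFinP; exact: (measurable_int mu).
  have [iG _ cG] : [/\ mu.-integrable D (EFin \o G),
    (\int[mu]_(x in D) `|(f' x * cutoff n x)%:E - (G x)%:E|)%E @[n --> \oo] --> 0%E &
    (\int[mu]_(x in D) (f' x * cutoff n x)%:E)%E @[n --> \oo] -->
      (\int[mu]_(x in D) (G x)%:E)%E].
    apply: (@dominated_convergence _ _ _ mu D mD
      (fun n x => (f' x * cutoff n x)%:E) _ (fun x => (smooth_step 1 * `|f' x|)%:E)).
    - move=> n; apply/measurable_EFinP; apply: measurable_funM; first exact: mf'.
      apply: (@measurable_funS _ _ _ _ setT) => //.
      apply: continuous_measurable_fun => x; apply: differentiable_continuous.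
      by apply/derivable1_diffP; have [+ _] := smooth_cutoff n 1; exact.
    - apply/measurable_EFinP; apply: measurable_fun_if; first exact: mD.
      + exact: measurable_fun_ltr.
      + by apply: measurable_funM; [exact: measurable_cst|exact: measurable_funS mf'].
      + exact: measurable_cst.
    - apply: aeW => x /=; rewrite in_itv/= => /andP[x0 _].
      apply: cvg_EFin; first exact: nearW.
      have -> : G x = f' x * (if x < b then smooth_step 1 else 0).
        by rewrite /G; case: ifP; rewrite ?mulr0// mulrC.
      exact: (cvgM (cvg_cst (f' x)) (cvg_cutoff x0)).
    - apply: (@integrableZl _ _ _ mu _ mD (smooth_step 1) (fun x => `|f' x|%:E)).
      exact: (@integrable_norm _ _ R mu _ f').
    - apply: aeW => x n _; rewrite abse_EFin lee_fin normrM mulrC.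
      by rewrite ler_wpM2r// cutoff_bounded.
  have -> : smooth_step 1 * \int[mu]_(t in `]0, b[) f' t = \int[mu]_(t in D) G t.
    have ib : mu.-integrable `]0, b[ (EFin \o f').
      apply: (@integrableS _ _ _ mu D) => //.
      by apply: subset_itvl; rewrite bnd_simp.
    rewrite -(@RintegralZl _ _ R mu _ _ _ mb ib).
    rewrite (Rintegral_mkcond mu D) (Rintegral_mkcond mu `]0, b[).
    apply: eq_Rintegral => t _; rewrite /patch /G !mem_setE !in_itv/=.
    case: (ltP 0 t) => //= _; case: (ltP t b) => [tb|]; last by case: ifP.
    by rewrite (lt_le_trans tb).
  apply: fine_cvg.
  rewrite fineK; first exact: cG.
  exact: (@integrable_fin_num _ _ R mu D mD _ iG).
have E : (fun n => \int[mu]_(t in D) (f t * derive1 (cutoff n) t)) =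
    (fun n => - \int[mu]_(t in D) (f' t * cutoff n t)).
  by apply/funext => n; exact/wd/test_function_cutoff.
rewrite E in lhs.
have := cvg_unique _ lhs (cvgN rhs).
move=> /(_ (@Rhausdorff R)) H.
apply: (mulfI (lt0r_neq0 S0)).
by rewrite -[RHS]opprK -H mulrBr opprB.
Qed.

End WeakDerivative.

Lemma W11_primitive {R : realType} (T : R) (f f' : R -> R) : 0 < T -> in_W11 T f f' ->
  forall t, t \in `[0, T] ->
  f t - f 0 = \int[@lebesgue_measure R]_(s in `]0, t[) f' s.
Proof.
move=> T0 fW t; rewrite in_itv/= => /andP[].
rewrite le_eqVlt => /predU1P[<- _|t0 tT]; last exact: W11_primitive_gt0 fW t0 tT.
by rewrite subrr set_itvoo0 Rintegral_set0.
Qed.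

(** * Equivalence of the two equations *)

Section FirstKind.
Context {R : realType}.
Local Notation mu := (@lebesgue_measure R).
Local Notation L1 f := (mu.-integrable setT (EFin \o f)).
Local Notation N f := (\int[mu]_x `|f x|).
Variables (T : R) (h k : R -> R).
Local Notation D := (`]0%R, T[%classic : set R).
Hypotheses (inth : L1 h) (h_causal : forall x, x <= 0 -> h x = 0).
Hypothesis kE : forall t, t \in `[0, T] ->
  k t = 1 + \int[mu]_(s in `]0, t[) h s.

Lemma L1norm_restrict (f : R -> R) : L1norm T f = N (f \_ D).
Proof.
rewrite /L1norm Rintegral_mkcond; apply: eq_Rintegral => x _.
by rewrite !restrictE; case: ifP => _; rewrite ?normr0.
Qed.

Lemma primitive_restrict (g : R -> R) t : t \in `[0, T] ->
  \int[mu]_(s in `]0, t[) (g \_ D) s = \int[mu]_(s in `]0, t[) g s.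
Proof.
rewrite in_itv/= => /andP[_ tT]; apply: eq_Rintegral => s.
rewrite restrictE !mem_setE !in_itv/= => /andP[s0 st].
by rewrite s0 (lt_le_trans st tT).
Qed.

Lemma ae_eq_primitive (f g : R -> R) t : t \in `[0, T] -> L1 f -> L1 g ->
  {ae mu, forall s, s \in `]0, T[ -> f s = g s} ->
  \int[mu]_(s in `]0, t[) f s = \int[mu]_(s in `]0, t[) g s.
Proof.
move=> tT intf intg fg.
have mD : measurable D by exact: measurable_itv.
rewrite -(primitive_restrict f tT) -(primitive_restrict g tT).
have mE : measurable (`]0%R, t[%classic : set R) by exact: measurable_itv.
rewrite Rintegral_mkcond [RHS]Rintegral_mkcond; apply: ae_eq_Rintegral.
- by apply: L1_measurable; apply: (L1_restrict mE); exact: (L1_restrict mD).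
- by apply: L1_measurable; apply: (L1_restrict mE); exact: (L1_restrict mD).
apply: filterS fg => s fg; rewrite !(restrictE _ `]0, t[); case: ifP => // _.
by rewrite !restrictE mem_setE; case: ifP => // sD; exact: fg.
Qed.

(** Integrate the equation of the second kind; the solution is first replaced by
    its restriction to ]0, T[, with which it agrees almost everywhere. *)
Lemma first_kind_of_second_kind (f g u : R -> R) : L1 u -> mu.-integrable D (EFin \o g) ->
  (forall t, t \in `[0, T] -> f t = \int[mu]_(s in `]0, t[) g s) ->
  {ae mu, forall t, u t = if t \in D then (g \_ D) t - line_conv h u t else 0} ->
  forall t, t \in `[0, T] -> Defs.conv k u t = f t.
Proof.
move=> intu intg fE uE t tT.
have mD : measurable D by exact: measurable_itv.
have intuD : mu.-integrable D (EFin \o u).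
  exact: (@integrableS _ _ R mu setT D _ measurableT mD (@subsetT _ _) intu).
have intw := L1_restrict mD intu.
rewrite fE// -(primitive_restrict g tT) -(primitive_conv inth intuD h_causal kE tT).
have uw : {ae mu, forall s, u s = (u \_ D) s}.
  by apply: filterS uE => s; rewrite (restrictE u); case: ifP.
have cE := ae_eq_line_conv (L1_measurable inth) (L1_measurable intu)
  (L1_measurable intw) uw.
apply: ae_eq_primitive => //.
- exact: (L1D intw (line_conv_integrable inth intw)).
- exact: L1_restrict_integrable.
apply: filterS uE => s uE sD; rewrite -cE (restrictE u) mem_setE sD uE mem_setE sD.
by rewrite subrK.
Qed.

(** Both sides of the first kind equation are primitives, so the difference
    of their densities has vanishing primitive. *)
Lemma second_kind_of_first_kind (f g v : R -> R) :
  mu.-integrable D (EFin \o v) -> mu.-integrable D (EFin \o g) ->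
  (forall t, t \in `[0, T] -> f t = \int[mu]_(s in `]0, t[) g s) ->
  (forall t, t \in `[0, T] -> Defs.conv k v t = f t) ->
  {ae mu, forall t, t \in `]0, T[ ->
    (v \_ D) t = (g \_ D) t - line_conv h (v \_ D) t}.
Proof.
move=> intv intg fE vf.
have intw := L1_restrict_integrable intv; have intgD := L1_restrict_integrable intg.
have intc := line_conv_integrable inth intw.
have mE t : measurable (`]0%R, t[%classic : set R) by exact: measurable_itv.
have sub (F : R -> R) t : L1 F -> mu.-integrable `]0, t[ (EFin \o F).
  exact: (@integrableS _ _ R mu setT _ _ measurableT (mE t) (@subsetT _ _)).
have := @primitive_eq0_ae _ T _ (L1B (L1D intw intc) intgD).
have Z t : t \in `[0, T] -> \int[mu]_(s in `]0, t[)
    (((v \_ D) \+ line_conv h (v \_ D)) \- (g \_ D)) s = 0.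
  move=> tT; rewrite (@RintegralB _ _ R mu _ _ _ (mE t) (sub _ _ (L1D intw intc))
    (sub _ _ intgD)).
  rewrite (primitive_restrict g tT) -fE//.
  by rewrite (primitive_conv inth intv h_causal kE tT) vf// subrr.
move=> /(_ Z); apply: filterS => s H sD; have /= := H sD.
by move/eqP; rewrite subr_eq0 => /eqP <-; rewrite addrK.
Qed.

End FirstKind.

(** * The Abel equation *)

Theorem theorem11 (R : realType) (T : R) (hT : 0 < T)
    (alpha alpha' alpha'' alpha''' : R -> R) (L : R) (hL : 0 < L)
    (halpha1 : deriv_on T alpha alpha')
    (halpha2 : deriv_on T alpha' alpha'')
    (halpha3 : deriv_on T alpha'' alpha''')
    (hbound : forall t, t \in `[0, T] ->
       `|alpha' t| + `|alpha'' t| + `|alpha''' t| <= L)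
    (halpha01 : forall t, t \in `]0, T] -> 0 < alpha t < 1)
    (halpha0 : alpha 0 = 0) :
  exists2 Q : R, 0 < Q &
    forall f f' : R -> R, in_W11 T f f' -> f 0 = 0 ->
    exists u : R -> R,
      [/\ abel_solution T alpha f u,
          forall v : R -> R, abel_solution T alpha f v ->
            {ae @lebesgue_measure R, forall t, t \in `]0, T[ -> v t = u t},
          L1norm T u <= Q * W11norm T f f' &
          forall Lf : R, 0 < Lf ->
            {ae @lebesgue_measure R, forall t, t \in `[0, T] -> `|f' t| <= Lf} ->
            {ae @lebesgue_measure R, forall t, t \in `[0, T] -> `|u t| <= Q * Lf}].
Proof.
have alpha'_le t : t \in `[0, T] -> `|alpha' t| <= L.
  move=> tT; apply: le_trans (hbound t tT).
  by rewrite -addrA lerDl addr_ge0.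
have [h [inth h_causal kE]] :=
  abel_kernel_primitive hT hL halpha1 halpha2 alpha'_le halpha01 halpha0.
have [Q Q0 volterra] := volterra_second_kind inth h_causal T.
exists Q => // f f' fW f0; have [_ intf intf' _] := fW.
have fE t : t \in `[0, T] ->
    f t = \int[@lebesgue_measure R]_(s in `]0, t[) f' s.
  by move=> tT; rewrite -(W11_primitive hT fW tT) f0 subr0.
have mD : measurable (`]0%R, T[%classic : set R) by exact: measurable_itv.
have [u [intu uE u_unique uN u_bound]] := volterra _ (L1_restrict_integrable intf').
exists u; split.
- split; last exact: (first_kind_of_second_kind inth h_causal kE intu intf' fE uE).
  exact: (@integrableS _ _ R (@lebesgue_measure R) setT _ _ measurableT mD
    (@subsetT _ _) intu).
- move=> v [intv vf].
  have vE := second_kind_of_first_kind inth h_causal kE intv intf' fE vf.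
  have : {ae @lebesgue_measure R, forall t, (v \_ `]0, T[) t = u t}.
    apply: u_unique; first exact: L1_restrict_integrable.
      by move=> t /negbTE tD; rewrite restrictE tD.
    by apply: filterS vE => t vE; rewrite mem_setE; exact: vE.
  by apply: filterS => t <- tD; rewrite restrictE mem_setE tD.
- have uD : L1norm T u <= \int[@lebesgue_measure R]_x `|u x|.
    rewrite L1norm_restrict; apply: ae_le_norm => //.
      by apply: L1_measurable; exact: (L1_restrict mD).
    apply: aeW => x; rewrite restrictE; case: ifP => // _.
    by rewrite normr0.
  apply: le_trans uD _; apply: le_trans uN _.
  rewrite -L1norm_restrict ler_wpM2l ?(ltW Q0)// /W11norm lerDr.
  by rewrite L1norm_restrict norm1_ge0.
- move=> Lf Lf0 f'_le.
  have : {ae @lebesgue_measure R, forall t, `|u t| <= Q * Lf}.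
    apply: u_bound; first exact: ltW.
    apply: filterS f'_le => t f'_le; rewrite restrictE mem_setE => tD.
    rewrite tD; apply: f'_le; apply: subset_itvW tD => //.
  by apply: filterS.
Qed.
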